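(* Let $G$ be a locally compact abelian group, let $\omega$ be a weight on $G$, and let $(\Phi,\Psi)$ be a complementary pair of continuous strictly increasing Young functions such that $(L^\Phi_\omega(G),* )$ is a Banach algebra. Suppose that there exists no nonzero continuous group homomorphism $\xi:G\to\mathbb{C}$ such that $\tilde\xi\in L^\infty(G)$, where $$\tilde\xi(s):=\frac{\xi(s)}{\omega(s)\,\omega(s^{-1})}\qquad(s\in G).$$ Then $\mathcal{S}^\Phi_\omega(G)$ is weakly amenable.
   Context: $G$ carries a fixed Haar measure $ds$, and $\mathbb{C}$ is regarded as an additive group. Young functions: a nonzero function $\Phi:[0,\infty)\to[0,\infty]$ is a Young function if it is convex, $\Phi(0)=0$ and $\lim_{x\to\infty}\Phi(x)=\infty$. Its complementary function is $\Psi(y)=\sup\{xy-\Phi(x):x\ge 0\}$ ($y\ge0$), which is again a Young function whose complementary function is $\Phi$; $(\Phi,\Psi)$ is then called a complementary pair. Orlicz spaces: $L^\Phi(G)$ is the space of (classes of) measurable $f:G\to\mathbb{C}$ with $\int_G\Phi(\alpha|f(s)|)\,ds<\infty$ for some $\alpha>0$, with norm $\|f\|_\Phi=\sup\{\int_G|f(s)v(s)|\,ds:\int_G\Psi(|v(s)|)\,ds\le1\}$. $\mathcal{S}^\Phi(G)$ is the closure in $L^\Phi(G)$ of the linear space of all step functions in $L^\Phi(G)$. Weights: a weight on $G$ is a locally integrable measurable function $\omega:G\to(0,\infty)$ with $\omega(e)=1$, $1/\omega\in L^\infty(G)$, and such that for some $C>0$, $\omega(st)\le C\omega(s)\omega(t)$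 for all $s,t\in G$. Weighted spaces: $L^\Phi_\omega(G)=\{f: f\omega\in L^\Phi(G)\}$ with norm $\|f\|_{\Phi,\omega}=\|f\omega\|_\Phi$, and $\mathcal{S}^\Phi_\omega(G)=\{f:f\omega\in\mathcal{S}^\Phi(G)\}$, a closed subspace. ''$(L^\Phi_\omega(G),* )$ is a Banach algebra'' means that it is a Banach algebra under convolution $*$, where multiplication is only required to be bounded ($\|f*g\|\le K\|f\|\|g\|$ for some constant $K$), not contractive. In that case $\mathcal{S}^\Phi_\omega(G)$ is a closed subalgebra. A Banach algebra $A$ is weakly amenable if every bounded derivation $D:A\to A^*$ is inner. *)

(* Defs.v *)
From HB Require Import structures.
From mathcomp Require Import all_boot all_order all_algebra.
From mathcomp Require Import complex.
From mathcomp Require Import all_classical all_reals all_analysis ess_sup_inf.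
Set Implicit Arguments.
Unset Strict Implicit.
Unset Printing Implicit Defensive.
Import Order.TTheory GRing.Theory Num.Theory numFieldNormedType.Exports.
Local Open Scope classical_set_scope.
Local Open Scope ring_scope.
Local Open Scope complex_scope.

(* The complex numbers over R are written R[i]^o: this form of R[i] carries
   the modulus topology and the structure of a vector space over R[i].
   Groups are written additively, following topologicalZmodType: s + t, - s
   and 0 stand for st, s^-1 and e. *)

Definition modulus (R : realType) (z : R[i]^o) : R := ComplexField.Normc.normc z.

(* T with its Borel sigma-algebra. *)
Definition borel (T : topologicalZmodType) : Type := T.

HB.instance Definition _ T := Choice.on (borel T).
HB.instance Definition _ T := isPointed.Build (borel T) (0 : T).
HB.instance Definition _ (T : topologicalZmodType) :=
  @isMeasurable.Build (sigma_display (@open T)) (borel T) <<s @open T >>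
    (@sigma_algebra0 _ setT (@open T)) (@sigma_algebraC (borel T) (@open T))
    (@sigma_algebra_bigcup _ setT (@open T)).

Section YoungFunctions.
Variable R : realType.
Local Open Scope ereal_scope.

(* A function [0, oo) -> [0, oo] is represented by a map R -> \bar R of which
   only the values at nonnegative arguments are used. *)
Record young (Phi : R -> \bar R) : Prop := Young {
  young_ge0 : forall x, (0 <= x)%R -> 0 <= Phi x;
  young_neq0 : exists2 x, (0 <= x)%R & Phi x <> 0;
  young_convex : forall x y t, (0 <= x)%R -> (0 <= y)%R -> (0 <= t <= 1)%R ->
    Phi (t * x + (1 - t) * y)%R <= t%:E * Phi x + (1 - t)%:E * Phi y;
  young_at0 : Phi 0%R = 0;
  young_lim : Phi x @[x --> +oo%R] --> +oo }.

Definition complementary (Phi : R -> \bar R) (y : R) : \bar R :=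
  ereal_sup [set (x * y)%:E - Phi x | x in [set x | (0 <= x)%R]].

Definition complementary_pair (Phi Psi : R -> \bar R) : Prop :=
  [/\ young Phi, young Psi &
      forall y, (0 <= y)%R -> Psi y = complementary Phi y].

Definition continuous_nneg (Phi : R -> \bar R) : Prop :=
  {within [set x : R | (0 <= x)%R], continuous Phi}.

Definition increasing_nneg (Phi : R -> \bar R) : Prop :=
  forall x y, (0 <= x)%R -> (x < y)%R -> Phi x < Phi y.

End YoungFunctions.

Section Algebras.
Variable R : realType.

(* An algebra whose elements are classes is given by representatives: those
   in acarrier, two of them being identified when their difference is in
   anull. *)
Record class_algebra := ClassAlgebra {
  arep :> lmodType R[i];
  acarrier : set arep;
  anull : set arep;
  anorm : arep -> \bar R;
  amul : arep -> arep -> arep }.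

Variable A : class_algebra.
Implicit Types (a : R[i]) (x y z : A).

Record banach_algebra : Prop := BanachAlgebra {
  ba_0 : acarrier (0 : A);
  ba_lin : forall a x y, acarrier x -> acarrier y -> acarrier (a *: x + y);
  ba_norm_ge0 : forall x, acarrier x -> (0 <= anorm x)%E;
  ba_norm_fin : forall x, acarrier x -> (anorm x < +oo)%E;
  ba_norm_eq0 : forall x, acarrier x -> anorm x = 0%E <-> anull x;
  ba_normZ : forall a x, acarrier x ->
    anorm (a *: x) = ((modulus a)%:E * anorm x)%E;
  ba_normD : forall x y, acarrier x -> acarrier y ->
    (anorm (x + y)%R <= anorm x + anorm y)%E;
  ba_complete : forall u : nat -> A, (forall n, acarrier (u n)) ->
    (forall e : R, 0 < e -> exists N, forall m n, (N <= m)%N -> (N <= n)%N ->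
      (anorm (u m - u n)%R < e%:E)%E) ->
    exists2 x, acarrier x & anorm (u n - x) @[n --> \oo] --> 0%E;
  ba_mul : forall x y, acarrier x -> acarrier y -> acarrier (amul x y);
  ba_mul_linl : forall a x y z, acarrier x -> acarrier y -> acarrier z ->
    anull (amul (a *: x + y) z - (a *: amul x z + amul y z));
  ba_mul_linr : forall a x y z, acarrier x -> acarrier y -> acarrier z ->
    anull (amul z (a *: x + y) - (a *: amul z x + amul z y));
  ba_mulA : forall x y z, acarrier x -> acarrier y -> acarrier z ->
    anull (amul (amul x y) z - amul x (amul y z));
  ba_norm_mul : exists K : R, forall x y, acarrier x -> acarrier y ->
    (anorm (amul x y) <= K%:E * (anorm x * anorm y))%E }.

Record dual (phi : A -> R[i]^o) : Prop := Dual {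
  dual_lin : forall a x y, acarrier x -> acarrier y ->
    phi (a *: x + y) = a *: phi x + phi y;
  dual_null : forall x, acarrier x -> anull x -> phi x = 0;
  dual_bounded : exists K : R, forall x, acarrier x ->
    ((modulus (phi x))%:E <= K%:E * anorm x)%E }.

(* The dual is a bimodule by (x . phi)(z) = phi (z x) and
   (phi . x)(z) = phi (x z). *)
Record bounded_derivation (D : A -> A -> R[i]^o) : Prop := BoundedDerivation {
  der_dual : forall x, acarrier x -> dual (D x);
  der_lin : forall a x y z, acarrier x -> acarrier y -> acarrier z ->
    D (a *: x + y) z = a *: D x z + D y z;
  der_null : forall x z, acarrier x -> acarrier z -> anull x -> D x z = 0;
  der_bounded : exists K : R, forall x z, acarrier x -> acarrier z ->
    ((modulus (D x z))%:E <= K%:E * (anorm x * anorm z))%E;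
  der_mul : forall x y z, acarrier x -> acarrier y -> acarrier z ->
    D (amul x y) z = D y (amul z x) + D x (amul y z) }.

Definition inner_derivation (D : A -> A -> R[i]^o) : Prop :=
  exists2 phi, dual phi & forall x z, acarrier x -> acarrier z ->
    D x z = phi (amul z x) - phi (amul x z).

Definition weakly_amenable : Prop :=
  forall D, bounded_derivation D -> inner_derivation D.

End Algebras.

Section OrliczAlgebras.
Variables (R : realType) (G : topologicalZmodType).
Variable mu : {measure set (borel G) -> \bar R}.
Implicit Types (f g v : G -> R[i]^o) (w : G -> R) (Phi Psi : R -> \bar R).

(* Haar measures are Radon: outer regular on Borel sets, inner regular on open
   sets. *)
Record haar_measure : Prop := HaarMeasure {
  haar_compact : forall K : set G, compact K -> (mu K < +oo)%E;
  haar_outer : forall B : set (borel G), measurable B ->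
    mu B = ereal_inf [set mu U | U in [set U : set G | open U /\ B `<=` U]];
  haar_inner : forall U : set G, open U ->
    mu U = ereal_sup [set mu K | K in [set K : set G | compact K /\ K `<=` U]];
  haar_translation : forall (s : G) (B : set (borel G)), measurable B ->
    mu [set s + t | t in (B : set G)] = mu B;
  haar_neq0 : mu setT <> 0%E }.

Definition cmeasurable f : Prop :=
  measurable_fun setT (f : borel G -> borel R[i]^o).

Definition cintegrable f : Prop :=
  mu.-integrable setT (fun s : borel G => (complex.Re (f s))%:E) /\
  mu.-integrable setT (fun s : borel G => (complex.Im (f s))%:E).

(* Meaningful only when f is cintegrable. *)
Definition cintegral f : R[i]^o :=
  (\int[mu]_s complex.Re (f s)) +i* (\int[mu]_s complex.Im (f s)).

Definition Linfty f : Prop :=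
  cmeasurable f /\ (ess_sup mu (fun s => (modulus (f s))%:E) < +oo)%E.

Definition LPhi Phi f : Prop :=
  cmeasurable f /\ exists2 al : R, 0 < al &
    (\int[mu]_s Phi (al * modulus (f s))%R < +oo)%E.

Definition orlicz_norm Psi f : \bar R :=
  ereal_sup [set \int[mu]_s (modulus (f s * v s))%:E
    | v in [set v | cmeasurable v /\ (\int[mu]_s Psi (modulus (v s)) <= 1)%E]]%E.

Definition step_function f : Prop := cmeasurable f /\ finite_set (range f).

(* The closure is taken in LPhi, for the Orlicz norm. *)
Definition SPhi Phi Psi f : Prop :=
  LPhi Phi f /\ forall e : R, 0 < e ->
    exists g, [/\ step_function g, LPhi Phi g &
      (orlicz_norm Psi (f - g)%R < e%:E)%E].

Record weight w : Prop := Weight {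
  weight_measurable : measurable_fun setT (w : borel G -> R);
  weight_locally_integrable : forall K : set G, compact K ->
    (\int[mu]_(s in (K : set (borel G))) (w s)%:E < +oo)%E;
  weight_gt0 : forall s, 0 < w s;
  weight_0 : w 0 = 1;
  weight_inv : Linfty (fun s => ((w s)^-1)%:C);
  weight_mul : exists2 C : R, 0 < C & forall s t, w (s + t) <= C * w s * w t }.

Definition weighted w f : G -> R[i]^o := fun s => f s * (w s)%:C.

Definition weighted_norm Psi w f : \bar R := orlicz_norm Psi (weighted w f).

Definition convolution f g : G -> R[i]^o :=
  fun s => cintegral (fun t => f t * g (s - t)).

(* The integral defining convolution f g converges absolutely almost
   everywhere. *)
Definition convolvable f g : Prop :=
  \forall s \ae mu, cintegrable (fun t => f t * g (s - t)).

Definition ae_zero f : Prop := \forall s \ae mu, f s = 0.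

Definition LPhiw Phi Psi w : class_algebra R :=
  @ClassAlgebra R (G -> R[i]^o) [set f | LPhi Phi (weighted w f)]
    ae_zero (weighted_norm Psi w) convolution.

Definition SPhiw Phi Psi w : class_algebra R :=
  @ClassAlgebra R (G -> R[i]^o) [set f | SPhi Phi Psi (weighted w f)]
    ae_zero (weighted_norm Psi w) convolution.

Definition LPhiw_banach_algebra Phi Psi w : Prop :=
  (forall f g, LPhi Phi (weighted w f) -> LPhi Phi (weighted w g) ->
    convolvable f g) /\
  banach_algebra (LPhiw Phi Psi w).

Definition tilde w (xi : G -> R[i]^o) : G -> R[i]^o :=
  fun s => xi s / (w s * w (- s))%:C.

End OrliczAlgebras.

(* Main.v *)
Require Import Defs.
From mathcomp Require Import all_boot all_order all_algebra.
From mathcomp Require Import complex.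
From mathcomp Require Import all_classical all_reals all_analysis.
From mathcomp Require Import measurable_realfun ess_sup_inf.
From mathcomp Require Import ring lra zify.
Set Implicit Arguments.
Unset Strict Implicit.
Unset Printing Implicit Defensive.
Import Order.TTheory GRing.Theory Num.Theory numFieldNormedType.Exports.
Local Open Scope classical_set_scope.
Local Open Scope ring_scope.
Local Open Scope complex_scope.

(** The derivations from A = S^Phi_w(G) to its dual that are inner vanish, as A is
    commutative; so the theorem says that a bounded derivation D : A -> A^* is 0.
    If A contained the point masses delta_s, the function
    s |-> delta_(-s) . D(delta_s) would be additive. Their action on A by the
    translations tau_s is enough: for f, k, g bounded with compact support let
    A(s) = D(tau_s f)(tau_(-s) (k * g)). The derivation rule for
    (tau_s f) * (tau_t k), evaluated at tau_(-s-t) g, shows that A(s) - A(0) is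
    additive in s (D_translate_pair_additive), and it is bounded by a multiple of
    w(s) w(-s), because tau_s has norm at most C w(s) (nrm_translate). Being bounded
    near 0, it is continuous; here w is bounded near 0 by the Steinhaus theorem
    (weight_near0). By hypothesis it vanishes (hom_trivial), and with an approximate
    unit g one gets D(tau_s f)(z) = D(f)(tau_s z) (D_translate).

    A convolution f * y is a limit of combinations of translates of y, so it follows
    that D(f * g)(h) = D(g)(f * h) (D_conv). Associativity then makes D(f)(g * h)
    symmetric in g and h (D_convC). Compared with the derivation rule
    D(f * g)(h) = D(g)(h * f) + D(f)(g * h), this leaves D(f)(g * h) = 0, and D = 0
    because the products are dense (D_eq0).

    The limits are taken on real continuous functions with compact support, which
    are dense (wS_density): regularity of the Haar measure approximates indicators by
    Urysohn functions, and Young's inequality bounds the norm of the indicator of a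
    set of small measure (orlicz_norm_indic). On such functions x * y is a uniform
    limit, within a fixed compact set, of combinations of translates of y
    (rconv_translate_approx), and a uniform limit within a compact set is a limit
    in A, w being bounded there (nrm_le_compact). *)

(** * Compact sets in topological groups *)

Section TopologicalGroups.
Variable G : topologicalZmodType.

Lemma continuous_addl (a : G) : continuous (fun x : G => a + x).
Proof.
move=> x; apply: (@continuous_comp _ _ _ (fun x => (a, x))
  (fun x : G * G => x.1 + x.2)).
  by apply: cvg_pair; [exact: cvg_cst|exact: cvg_id].
exact: add_continuous.
Qed.

Lemma nbhs_shift (a : G) (U : set G) : nbhs a U <->
  \forall v \near (0 : G), U (a + v).
Proof.
split=> aU.
  by have := @continuous_addl a 0; rewrite /continuous_at addr0 => /(_ _ aU).
have := @continuous_addl (- a) a; rewrite /continuous_at addNr => /(_ _ aU) h.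
have h2 : nbhs a [set x | U (a + (- a + x))] by exact: h.
by apply: filterS h2 => x /=; rewrite addNKr.
Qed.

Lemma compact_nbhs_sub (K U : set G) : compact K -> open U -> K `<=` U ->
  \forall v \near (0 : G), forall x, K x -> U (x + v).
Proof.
move=> /compact_near_coveringP cK oU KU.
apply: (cK G (nbhs (0:G)) (fun v x => U (x + v))) => x Kx.
have := @add_continuous G (x, 0); rewrite /continuous_at /= addr0; apply.
by apply: open_nbhs_nbhs; split => //; exact: KU.
Qed.

(** Near covering is applied to the filter of the sequences that contain a given
    finite one: for points near x and sequences containing x, the centre x
    itself works. *)
Lemma compact_cover_shift (K V : set G) : compact K -> nbhs 0 V ->
  exists s : seq G, (forall a, a \in s -> K a) /\
    forall x, K x -> exists2 a, a \in s & V (x - a).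
Proof.
move=> /compact_near_coveringP cK V0.
pose F : set_system (seq G) := [set S | exists s0 : seq G, forall s : seq G,
  {subset s0 <= s} -> S s].
have FF : Filter F.
  split; first by exists [::].
  - move=> P Q [s1 h1] [s2 h2]; exists (s1 ++ s2) => s ss; split.
      by apply: h1 => a as1; apply: ss; rewrite mem_cat as1.
    by apply: h2 => a as1; apply: ss; rewrite mem_cat as1 orbT.
  - by move=> P Q PQ [s1 h1]; exists s1 => s ss; apply/PQ/h1.
have := cK _ F (fun s x => exists2 a, a \in s & K a /\ V (x - a)) FF; case.
  move=> x Kx; exists ([set y | V (y - x)], [set s : seq G | x \in s]) => /=.
    split; last by exists [:: x] => s ss /=; apply: ss; rewrite inE.
    by apply/nbhs_shift; apply: filterS V0 => v Vv /=; rewrite addrC addKr.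
  by move=> [y s] /= [h1 h2]; exists x.
move=> s /(_ s (fun _ h => h)) h; exists [seq a <- s | `[< K a >]]; split.
  by move=> a; rewrite mem_filter => /andP[/asboolP].
move=> x /h [a sa [Ka Va]]; exists a => //.
by rewrite mem_filter sa andbT; exact/asboolP.
Qed.

Lemma compact_addset (A B : set G) : compact A -> compact B ->
  compact [set a + b | a in A & b in B].
Proof.
move=> cA cB.
have -> : [set a + b | a in A & b in B] = (fun x : G * G => x.1 + x.2) @` (A `*` B).
  apply/seteqP; split=> x /=.
    by move=> [a Aa] [b Bb <-]; exists (a, b).
  by move=> [[a b] /= [Aa Bb] <-]; exists a => //; exists b.
apply: continuous_compact; last exact: compact_setX.
by apply: continuous_subspaceT; exact: add_continuous.
Qed.

Hypothesis hG : hausdorff_space G.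
Hypothesis lcG : locally_compact [set: G].

Lemma compact_nbhs0 : exists2 V : set G, nbhs 0 V & compact V.
Proof.
have /= := @lcG 0 I; rewrite withinET => -[U U0 [cV _]]; exists U => //.
Qed.

Lemma compact_enlarge (K : set G) : compact K ->
  exists2 K' : set G, compact K' & K `<=` K'°.
Proof.
move=> cK; have [V V0 cV] := compact_nbhs0.
exists [set a + b | a in K & b in V]; first exact: compact_addset.
move=> x Kx; apply/nbhs_shift; apply: filterS V0 => v Vv.
by exists x => //; exists v.
Qed.

(** A locally compact Hausdorff space is completely regular, hence uniformizable.
    In a uniform space a compact set and a disjoint closed set are separated by
    an entourage, and Urysohn's lemma for uniform spaces applies. *)
Lemma compact_urysohn (R : realType) (K U : set G) : compact K -> open U ->
  K `<=` U ->
  exists f : G -> R, [/\ continuous f, forall x, 0 <= f x <= 1,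
    forall x, K x -> f x = 1 & forall x, ~ U x -> f x = 0].
Proof.
move=> cK oU KU.
have crs := @locally_compact_completely_regular G R lcG hG.
pose X : uniformType := @completely_regular_uniformity.type R G crs.
have sep : @uniform_separator G (~` U) K.
  have [E entE EU] : exists2 E : set (X * X), entourage E &
      forall x y, K x -> E (x, y) -> U y.
    have cK' : compact (K : set X) by exact: cK.
    move/compact_near_coveringP : cK' => cK'.
    have EF : ProperFilter (@entourage X).
      split; last exact: entourage_filter.
      by move=> /(@entourage_refl X _ (0 : G)).
    have PF := @powerset_filter_from_filter _ (@entourage X) EF.
    have := cK' _ (powerset_filter_from (@entourage X))
      (fun E x => forall y, E (x, y) -> U y) _; case.
      move=> x Kx.
      have : @nbhs X X x U by apply: (@open_nbhs_nbhs G); split => //; exact: KU.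
      rewrite -nbhs_entourageE => -[E entE ExU].
      exists (xsection (split_ent E) x,
        [set E' : set (X * X)| E' `<=` split_ent E]) => /=.
        split; first by rewrite -(@nbhs_entourageE X); exists (split_ent E).
        by apply: small_set_sub; exact: entourage_split_ent.
      move=> [x' E'] /= [xx' E's] y x'y; apply: ExU; apply/xsectionP.
      by apply: (@entourage_split X x') => //; [exact/xsectionP|exact: E's].
    move=> M [h1 h2 [E ME]] h; exists E; first exact: h1.
    by move=> x y Kx Exy; exact: (h E ME x Kx y).
  apply: (@uniform_separatorW X (~` U) K).
  exists (E^-1)%relation; first exact: entourage_inv.
  rewrite -subset0 => -[x y] /= [[nUx Ky] Eyx]; apply: nUx.
  exact: (EU y).
have /(@uniform_separatorP _ R) [f [cf f01 f0 f1]] := sep.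
exists f; split => //.
- by move=> x; have /f01 := imageT f x; rewrite /= in_itv.
- by move=> x Kx; apply: f1; exists x.
- by move=> x nUx; apply: f0; exists x.
Qed.

(** Near covering bounds the difference for x in K. For x outside K either both
    values vanish, or x + v lies in K and the bound for - v applies there. *)
Lemma compact_uniform_continuous (R : realType) (f : G -> R) (K : set G) e :
  continuous f -> compact K -> (forall x, ~ K x -> f x = 0) -> 0 < e ->
  \forall v \near (0 : G), forall x, `|f (x + v) - f x| < e.
Proof.
move=> cf /compact_near_coveringP cK f0 e0.
have h : \forall v \near (0 : G), forall x, K x -> `|f (x + v) - f x| < e.
  apply: (cK G (nbhs (0:G)) (fun v x => `|f (x + v) - f x| < e)) => x Kx.
  have c : {for (x, (0 : G)), continuous (fun p : G * G => f (p.1 + p.2) - f p.1)}.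
    apply: cvgB; last first.
      by apply: (@continuous_comp _ _ _ fst f); [exact: cvg_fst|exact: cf].
    apply: (@continuous_comp _ _ _ (fun p : G * G => p.1 + p.2) f); last exact: cf.
    exact: add_continuous.
  have {}c : f (p.1 + p.2) - f p.1 @[p --> (x, (0 : G))] --> (0 : R).
    by have -> : 0 = f (x + 0) - f x; [rewrite addr0 subrr|exact: c].
  by move/cvgr0Pnorm_lt : c; exact.
have hN : \forall v \near (0 : G), forall x, K x -> `|f (x - v) - f x| < e.
  have := @opp_continuous G 0; rewrite /continuous_at oppr0 => /(_ _ h) h';
    exact: h'.
apply: filterS2 h hN => v h hN x.
have [Kx|nKx] := pselect (K x); first exact: h.
have [Kxv|nKxv] := pselect (K (x + v)); last by rewrite !f0// subrr normr0.
by rewrite distrC; have := hN _ Kxv; rewrite addrK.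
Qed.

Lemma compact_borel (K : set G) : compact K -> measurable (K : set (borel G)).
Proof.
move=> /(compact_closed hG) cK; rewrite -(setCK K).
by apply: measurableC; apply: sub_sigma_algebra; exact: closed_openC.
Qed.
End TopologicalGroups.

(** * Complex numbers and Borel measurability *)

Section ComplexModulus.
Variable R : realType.
Implicit Types z : R[i].

Lemma modulusE z : `|z| = (modulus (z : R[i]^o))%:C.
Proof. by case: z => a b; rewrite normc_def. Qed.
Lemma modulus_ge0 (z : R[i]^o) : 0 <= modulus z.
Proof. by case: z => a b; exact: sqrtr_ge0. Qed.
Lemma modulusM (z1 z2 : R[i]^o) :
  modulus ((z1 * z2) : R[i]^o) = modulus z1 * modulus z2.
Proof. exact: ComplexField.Normc.normcM. Qed.
Lemma modulusD (z1 z2 : R[i]^o) : modulus (z1 + z2) <= modulus z1 + modulus z2.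
Proof. exact: le_normcD. Qed.
Lemma modulus_eq0 (z : R[i]^o) : modulus z = 0 -> z = 0.
Proof. exact: ComplexField.Normc.eq0_normc. Qed.
Lemma modulusN (z : R[i]^o) : modulus (- z) = modulus z.
Proof. exact: normcN. Qed.
Lemma modulus_real (r : R) : modulus (r%:C : R[i]^o) = `|r|.
Proof. by rewrite /modulus /= expr0n /= addr0 sqrtr_sqr. Qed.
Lemma ReD (z1 z2 : R[i]^o) : complex.Re (z1 + z2) = complex.Re z1 + complex.Re z2.
Proof. by case: z1 z2 => ? ? []. Qed.
Lemma ImD (z1 z2 : R[i]^o) : complex.Im (z1 + z2) = complex.Im z1 + complex.Im z2.
Proof. by case: z1 z2 => ? ? []. Qed.
Lemma Re_modulus (z : R[i]^o) : `|complex.Re z| <= modulus z.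
Proof.
case: z => a b /=; rewrite -sqrtr_sqr /modulus /= ler_sqrt ?addr_ge0 ?sqr_ge0//.
by rewrite lerDl sqr_ge0.
Qed.
Lemma Im_modulus (z : R[i]^o) : `|complex.Im z| <= modulus z.
Proof.
case: z => a b /=; rewrite -sqrtr_sqr /modulus /= ler_sqrt ?addr_ge0 ?sqr_ge0//.
by rewrite lerDr sqr_ge0.
Qed.

Lemma continuous_modulus : continuous (@modulus R).
Proof.
move=> z; have FF : Filter (nbhs z) by exact: nbhs_filter.
apply/cvgrPdist_lt => e e0.
have e0' : 0 < e%:C by rewrite ltcR.
have H := @cvgr_dist_lt R[i] R[i]^o R[i]^o (nbhs z) FF id z
  (@cvg_id R[i]^o (nbhs z)) (e%:C) e0'.
apply: filterS H => y h.
have {}h : `|(z : R[i]) - (y : R[i])| < e%:C by exact: h.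
have {}h : `| `|(z : R[i])| - `|(y : R[i])| | < e%:C.
  by apply: le_lt_trans h; exact: ler_dist_dist.
by move: h; rewrite 2!modulusE -rmorphB modulusE modulus_real ltcR.
Qed.

Lemma continuous_real_complex : continuous (fun r : R => (r%:C : R[i]^o)).
Proof.
move=> r; apply/cvgrPdist_lt => e e0.
have eE : e = (complex.Re e)%:C.
  by case: e e0 => a b; rewrite ltcE /= => /andP[/eqP -> _].
have e0' : 0 < complex.Re e by rewrite -ltcR -eE.
near=> t.
suff : `|(r%:C : R[i]) - t%:C| < e by [].
rewrite -rmorphB /= modulusE modulus_real eE ltcR.
by near: t; apply: cvgr_dist_lt.
Unshelve. all: by end_near. Qed.

Lemma continuous_borel (T1 T2 : topologicalZmodType) (f : T1 -> T2) :
  continuous f ->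
  measurable_fun setT (f : borel T1 -> borel T2).
Proof.
move=> cf; apply: (@measurability _ _ (borel T1) (borel T2) setT f (@open T2)) =>
  //.
move=> _ [B oB <-]; rewrite setTI; apply: sub_sigma_algebra.
by apply: open_comp => // x _; exact: cf.
Qed.

Lemma continuous_borelR (T : topologicalZmodType) (f : T -> R) : continuous f ->
  measurable_fun setT (f : borel T -> R).
Proof.
move=> cf; apply: (measurability _ (RGenOInfty.measurableE R)) => //.
move=> _ [_ [x ->] <-]; rewrite setTI; apply: sub_sigma_algebra.
apply: open_comp; first by move=> y _; exact: cf.
by rewrite set_itvE; exact: open_gt.
Qed.

Lemma measurable_real_complex d (T : measurableType d) (u : T -> R) :
  measurable_fun setT u -> measurable_fun setT
    ((fun t => (u t)%:C) : T -> borel R[i]^o).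
Proof.
move=> mu; apply: (@measurability _ _ T (borel R[i]^o) setT _ (@open R[i]^o)) => //.
move=> _ [B oB <-].
apply: (mu measurableT ((fun r : R => (r%:C : R[i]^o)) @^-1` B)).
apply: open_measurable; apply: open_comp => // x _; exact: continuous_real_complex.
Qed.

Lemma measurable_modulus (T : topologicalZmodType) (f : T -> R[i]^o) :
  cmeasurable f ->
  measurable_fun setT ((fun t => modulus (f t)) : borel T -> R).
Proof.
move=> mf; have m1 := @continuous_borelR R[i]^o _ continuous_modulus.
exact: (measurableT_comp m1 mf).
Qed.
End ComplexModulus.

(** * Haar measure and the Steinhaus theorem *)

Section HaarMeasure.
Variables (R : realType) (G : topologicalZmodType).
Hypothesis hG : hausdorff_space G.
Hypothesis lcG : locally_compact [set: G].
Variable mu : {measure set (borel G) -> \bar R}.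
Hypothesis haar_mu : haar_measure mu.

Lemma measurable_shift (s : G) :
  measurable_fun setT ((fun t => t + s) : borel G -> borel G).
Proof.
apply: continuous_borel => t; have ->
  : (fun t => t + s) = (fun t => s + t) by apply/funext => x; rewrite addrC.
exact: continuous_addl.
Qed.

Lemma measure_shift (s : G) (B : set G) : measurable (B : set (borel G)) ->
  mu [set t | B (t + s)] = mu B.
Proof.
move=> mB; rewrite -(haar_translation haar_mu (- s) mB); congr (mu _).
apply/seteqP; split=> x /=; first by exists (x + s) => //; rewrite addrC addrK.
by move=> [t Bt <-]; rewrite addrAC addNr add0r.
Qed.

Lemma ge0_integral_shift (f : G -> \bar R) (s : G) :
  measurable_fun setT (f : borel G -> \bar R) -> (forall t, 0 <= f t)%E ->
  (\int[mu]_t f (t + s)%R = \int[mu]_t f t)%E.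
Proof.
move=> mf f0.
have := @ge0_integral_pushforward _ _ _ _ _ _ (measurable_shift s) mu setT f
  measurableT mf (fun x _ => f0 x).
rewrite preimage_setT => <-; apply: eq_measure_integral => [|mm A mA AT];
  first exact: measurable_shift.
by rewrite /= /pushforward (measure_shift s mA).
Qed.

Lemma integral_shift (f : G -> R) (s : G) :
  measurable_fun setT (f : borel G -> R) ->
  \int[mu]_t f (t + s) = \int[mu]_t f t.
Proof.
move=> mf; rewrite /Rintegral; congr fine.
have mf' : measurable_fun setT (EFin \o f : borel G -> \bar R) by
  exact/measurable_EFinP.
rewrite integralE [RHS]integralE; congr (_ - _)%E.
  rewrite -(ge0_integral_shift s (measurable_funepos mf') (funepos_ge0 _)).
  by apply: eq_integral => x _; rewrite !funeposE.
rewrite -(ge0_integral_shift s (measurable_funeneg mf') (funeneg_ge0 _)).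
by apply: eq_integral => x _; rewrite !funenegE.
Qed.

(** Were U null, each compact set would be covered by finitely many null
    translates of U, and inner regularity would make the whole group null. *)
Lemma haar_open_gt0 (U : set G) : open U -> U !=set0 -> (0 < mu U)%E.
Proof.
move=> oU [u Uu]; rewrite lt0e measure_ge0 andbT; apply/eqP => U0.
apply: (haar_neq0 haar_mu); apply/eqP; rewrite eq_le measure_ge0 andbT.
rewrite (haar_inner haar_mu openT); apply: ge_ereal_sup => _ [K [cK _] <-].
have mU : measurable (U : set (borel G)) by exact: sub_sigma_algebra.
have V0 : nbhs 0 [set v | U (u + v)].
  exact: (proj1 (nbhs_shift u U) (open_nbhs_nbhs (conj oU Uu))).
have [s [_ sK]] := compact_cover_shift cK V0.
have : K `<=` \big[setU/set0]_(a <- s) [set x | U (x + (u - a))].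
  move=> x /sK[a sa /= Ua]; rewrite -bigcup_seq; exists a => //=.
  by rewrite addrCA.
move=> Ks; have mS a : measurable ([set x | U (x + (u - a))] : set (borel G)).
  by rewrite -[X in measurable X]setTI; exact: (measurable_shift (u - a)).
suff mS0 : mu (\big[setU/set0]_(a <- s) [set x | U (x + (u - a))]) = 0%E.
  rewrite -mS0; apply: le_measure; rewrite ?inE//; first exact: compact_borel.
  exact: bigsetU_measurable.
elim: s {sK Ks} => [|a s IH]; first by rewrite big_nil measure0.
rewrite big_cons; apply/eqP; rewrite eq_le measure_ge0 andbT.
apply: (le_trans (measureU2 _ _ _)) => //; first exact: bigsetU_measurable.
rewrite -[leRHS]adde0; apply: leeD; last by rewrite le_eqVlt; apply/orP; left;
  apply/eqP; exact: IH.
by rewrite -[leRHS]U0 -[leRHS](measure_shift (u - a) mU).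
Qed.

(** Inner regularity holds for open sets, so K approximates U rather than B and
    may stick out of B; its excess over B is small because that of U is. *)
Lemma haar_approx (B : set G) e : measurable (B : set (borel G)) ->
  (mu B < +oo)%E -> 0 < e ->
  exists K U : set G, [/\ [/\ compact K, open U, B `<=` U & K `<=` U],
     (mu U < +oo)%E, (mu (U `\` B) < e%:E)%E & (mu (U `\` K) < e%:E)%E ].
Proof.
move=> mB Boo e0.
have Bfin : mu B \is a fin_num by rewrite ge0_fin_numE ?measure_ge0.
have [U [oU BU] Ue] : exists2 U : set G, open U /\
  B `<=` U & (mu U < mu B + e%:E)%E.
  have := lb_ereal_inf_adherent e0
    (S := [set mu U | U in [set U : set G | open U /\ B `<=` U]]).
  rewrite -haar_outer// => /(_ Bfin)[_ [U [oU BU] <-] lt].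
  by exists U.
have mU : measurable (U : set (borel G)) by exact: sub_sigma_algebra.
have Uoo : (mu U < +oo)%E by apply: (lt_trans Ue);
  rewrite -(fineK Bfin) -EFinD ltry.
have Ufin : mu U \is a fin_num by rewrite ge0_fin_numE ?measure_ge0.
have [K [cK KU] Ke] : exists2 K : set G, compact K /\
  K `<=` U & (mu U - e%:E < mu K)%E.
  have := ub_ereal_sup_adherent e0
    (S := [set mu K | K in [set K : set G | compact K /\ K `<=` U]]).
  rewrite -haar_inner// => /(_ Ufin)[_ [K [oK BK] <-] lt].
  by exists K.
have mK := compact_borel hG cK.
exists K, U; split => //.
- rewrite measureD// setIidr// lteBlDl ?Ufin//.
- rewrite measureD// setIidr// lteBlDl//; last first.
    by rewrite ge0_fin_numE ?measure_ge0// (le_lt_trans _ Uoo)// le_measure ?inE.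
  by rewrite -lteBlDr.
Qed.

(** Take K and U as in haar_approx and v so small that K + v stays in U. If E and
    E + v were disjoint, U would contain two disjoint copies of E `&` K and have
    measure nearly 2 mu E, whereas its measure is nearly mu E. *)
Lemma steinhaus (E : set G) : measurable (E : set (borel G)) -> (0 < mu E)%E ->
  (mu E < +oo)%E ->
  \forall v \near (0 : G), exists2 x, E x & E (x + v).
Proof.
move=> mE E0 Eoo.
have Efin : mu E \is a fin_num by rewrite ge0_fin_numE ?measure_ge0.
(* An error d < mu E / 3 contradicts 2 (mu E - d) <= mu E + d. *)
have e0 : 0 < fine (mu E) / 3 by rewrite divr_gt0// fine_gt0// E0.
have [K [U [[cK oU EU KU] Uoo UE UK]]] := haar_approx mE Eoo e0.
have mK := compact_borel hG cK.
have mU : measurable (U : set (borel G)) by exact: sub_sigma_algebra.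
apply: filterS (compact_nbhs_sub cK oU KU) => v vKU.
apply: contrapT => nE.
pose F := E `&` K; have mF : measurable (F : set (borel G)) by exact: measurableI.
pose F' := [set x | F (x - v)].
have mF' : measurable (F' : set (borel G)).
  by rewrite -[X in measurable X]setTI; exact: (measurable_shift (- v)).
have FF' : F `&` F' = set0.
  rewrite -subset0 => x [[Ex Kx] [Exv Kxv]]; apply: nE.
  by exists (x - v) => //; rewrite subrK.
have FU : F `|` F' `<=` U.
  move=> x [[Ex _]|[_ Kx]]; first exact: EU.
  by have := vKU _ Kx; rewrite subrK.
have muF : (mu E <= mu F + mu (U `\` K))%E.
  apply: (@le_trans _ _ (mu (F `|` (U `\` K)))).
    apply: le_measure; rewrite ?inE//; first by apply: measurableU => //;
      exact: measurableD.
    move=> x Ex; have [Kx|nKx] := pselect (K x); first by left.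
    by right; split => //; exact: EU.
  by apply: measureU2 => //; exact: measurableD.
have muU : (mu F + mu F <= mu E + mu (U `\` E))%E.
  rewrite -{2}(measure_shift (- v) mF) -measureU//.
  apply: (@le_trans _ _ (mu U)); first by rewrite le_measure ?inE//;
    exact: measurableU.
  rewrite -measureU//; last 2 first.
  - exact: measurableD.
  - by rewrite -subset0 => x [Ex [_ nEx]].
  by rewrite le_measure ?inE//;
    [apply: measurableU => //; exact: measurableD| rewrite setDUK].
have fin A : (mu A < +oo)%E -> mu A \is a fin_num by move=> h; rewrite ge0_fin_numE.
have fF : mu F \is a fin_num.
  by apply: fin; apply: (le_lt_trans _ Eoo); apply: le_measure; rewrite ?inE//;
    exact: subIsetl.
have fUE : mu (U `\` E) \is a fin_num by apply: fin; rewrite (lt_trans UE) ?ltry.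
have fUK : mu (U `\` K) \is a fin_num by apply: fin; rewrite (lt_trans UK) ?ltry.
move: muF muU UE UK e0.
rewrite -(fineK Efin) -(fineK fF) -(fineK fUE) -(fineK fUK).
rewrite -!EFinD !lee_fin !lte_fin /=.
lra.
Qed.
End HaarMeasure.

(** * Test functions *)

Section CompactlySupported.
Variables (R : realType) (G : topologicalZmodType).
Hypothesis hG : hausdorff_space G.
Hypothesis lcG : locally_compact [set: G].
Variable mu : {measure set (borel G) -> \bar R}.
Hypothesis haar_mu : haar_measure mu.
Implicit Types (u v : G -> R).

(** The space of bounded Borel functions with compact support. Beside the
    continuous ones it contains the normalized indicators that serve as
    approximate units. *)
Definition Bc u : Prop :=
  [/\ measurable_fun setT (u : borel G -> R),
      exists M, forall s, `|u s| <= M &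
      exists2 K : set G, compact K & forall s, ~ K s -> u s = 0].

Definition Cc u : Prop :=
  continuous u /\ exists2 K : set G, compact K & forall s, ~ K s -> u s = 0.

Definition translate (s : G) (T : Type) (u : G -> T) : G -> T := fun t => u (t - s).

Lemma Cc_Bc u : Cc u -> Bc u.
Proof.
move=> [cu [K cK uK]]; split; [exact: continuous_borelR| |by exists K].
have /compact_bounded : compact (u @` K).
  by apply: continuous_compact => //; exact: continuous_subspaceT.
case=> M [_ hM]; exists (Num.max (M + 1) 0) => s.
have [Ks|nKs] := pselect (K s); last by rewrite uK// normr0 le_max lexx orbT.
rewrite le_max; apply/orP; left; apply: (hM (M + 1)); first by rewrite ltrDl.
by exists s.
Qed.

Lemma Bc_integrable u : Bc u -> mu.-integrable setT (EFin \o u : borel G -> \bar R).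
Proof.
move=> [mu_ [M uM] [K cK uK]]; apply/integrableP; split;
  first exact/measurable_EFinP.
have mK := compact_borel hG cK.
have -> : (\int[mu]_x `|(EFin \o u) x| = \int[mu]_(x in K) `|(EFin \o u) x|)%E.
  rewrite [RHS]integral_mkcond; apply: eq_integral => x _.
  rewrite patchE; case: ifPn => // /negP nK; rewrite /= uK ?normr0//.
  by move=> Kx; apply: nK; rewrite inE.
apply: (@le_lt_trans _ _ (\int[mu]_(x in K) (M%:E))%E).
  apply: ge0_le_integral => //.
  - by apply: measurableT_comp => //; apply: measurable_funTS;
    exact/measurable_EFinP.
  - by move=> x _; rewrite /= lee_fin.
rewrite integral_cst//=; have := haar_compact haar_mu cK.
rewrite -ge0_fin_numE ?measure_ge0// => /fineK <-.
by rewrite -EFinM ltry.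
Qed.

Lemma Bc_comp u (phi phi' : G -> G) : Bc u -> continuous phi -> continuous phi' ->
  cancel phi phi' -> Bc (u \o phi).
Proof.
move=> [m [M uM] [K cK uK]] cphi cphi' can; split.
- by apply: (measurableT_comp m); exact: continuous_borel.
- by exists M => s; exact: uM.
exists (phi' @` K).
  by apply: continuous_compact => //; exact: continuous_subspaceT.
by move=> s nK; apply: uK => Ks; apply: nK; exists (phi s).
Qed.

Lemma continuous_subr (s : G) : continuous (fun t : G => t - s).
Proof.
by move=> t; have -> : (fun t => t - s) =
  (fun t => - s + t) by [apply/funext => x; rewrite addrC|]; exact: continuous_addl.
Qed.

Lemma continuous_reflect (s : G) : continuous (fun t : G => s - t).
Proof.
move=> t; apply: (@continuous_comp _ _ _ -%R (fun t => s + t)).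
  exact: opp_continuous.
exact: continuous_addl.
Qed.

Lemma Bc_translate s u : Bc u -> Bc (translate s u).
Proof.
move=> nu; apply: (@Bc_comp u (fun t => t - s) (fun t => t - (- s))) => //;
  try exact: continuous_subr.
by move=> t; rewrite opprK subrK.
Qed.

Lemma Bc_reflect s u : Bc u -> Bc (fun t => u (s - t)).
Proof.
move=> nu; apply: (@Bc_comp u (fun t => s - t) (fun t => s - t)) => //;
  try exact: continuous_reflect.
by move=> t; rewrite opprB addrC subrK.
Qed.

Lemma Cc_translate s u : Cc u -> Cc (translate s u).
Proof.
move=> Cu; have [_ _ sup] := Bc_translate s (Cc_Bc Cu).
split => // t; apply: (@continuous_comp _ _ _ (fun t => t - s) u);
  first exact: continuous_subr.
by case: Cu => + _; apply.
Qed.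

Lemma Bc_mul u v : Bc u -> Bc v -> Bc (fun t => u t * v t).
Proof.
move=> [m1 [M1 b1] [K1 c1 z1]] [m2 [M2 b2] _]; split; first exact: measurable_funM.
- by exists (M1 * M2) => s; rewrite normrM ler_pM.
- by exists K1 => // s nK; rewrite z1// mul0r.
Qed.

Lemma BcZ a u : Bc u -> Bc (fun t => a * u t).
Proof.
move=> [m1 [M1 b1] [K1 c1 z1]]; split; first exact: measurable_funM.
- by exists (`|a| * M1) => s; rewrite normrM ler_wpM2l.
- by exists K1 => // s nK; rewrite z1// mulr0.
Qed.

Lemma BcB u v : Bc u -> Bc v -> Bc (fun t => u t - v t).
Proof.
move=> [m1 [M1 b1] [K1 c1 z1]] [m2 [M2 b2] [K2 c2 z2]]; split.
- exact: measurable_funB.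
- by exists (M1 + M2) => s; apply: (le_trans (ler_normB _ _)); exact: lerD.
- exists (K1 `|` K2); first exact: compactU.
  by move=> s nK; rewrite z1 ?z2 ?subrr// => Ks; apply: nK; [right|left].
Qed.

Lemma Bc_norm u : Bc u -> Bc (fun t => `|u t|).
Proof.
move=> [m1 [M uM] [K cK uK]]; split; first exact: measurableT_comp.
  by exists M => t; rewrite normr_id.
by exists K => // t nK; rewrite uK// normr0.
Qed.

Lemma Bc_indic (B K : set G) : measurable (B : set (borel G)) -> compact K ->
  B `<=` K ->
  Bc (\1_B).
Proof.
move=> mB cK BK; split; first exact: measurable_indic.
- by exists 1 => s; rewrite indicE; case: (_ \in _); rewrite ?normr1 ?normr0.
- exists K => // s nK; rewrite indicE memNset//; by move=> /BK.
Qed.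

Definition cplx u : G -> R[i]^o := fun s => (u s)%:C.
Definition rconv u v : G -> R := fun s => \int[mu]_t (u t * v (s - t)).

(** Reduces the convolutions that have to be estimated to real integrals. *)
Lemma convolution_cplx u v : convolution mu (cplx u) (cplx v) = cplx (rconv u v).
Proof.
apply/funext => s; rewrite /convolution /cintegral /cplx.
have -> : \int[mu]_t complex.Re ((u t)%:C * (v (s - t))%:C) = rconv u v s.
  by apply: eq_Rintegral => t _; rewrite /= mul0r subr0.
have -> : \int[mu]_t complex.Im ((u t)%:C * (v (s - t))%:C) = \int[mu]_t (cst 0 t).
  by apply: eq_Rintegral => t _; rewrite /= mul0r mulr0 addr0.
by rewrite /Rintegral integral0.
Qed.

Lemma rconv_translater s u v : rconv u (translate s v) = translate s (rconv u v).
Proof. by apply/funext => x; apply: eq_Rintegral => t _; rewrite /translate addrAC.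
  Qed.

Lemma rconv_translatel s u v : Bc u -> Bc v ->
  rconv (translate s u) v = translate s (rconv u v).
Proof.
move=> nu nv; apply/funext => x; rewrite /rconv /translate.
rewrite -(integral_shift haar_mu s); last first.
  have [] // : Bc (fun t => u (t - s) * v (x - t)).
  by apply: Bc_mul; [exact: Bc_translate|exact: Bc_reflect].
by apply: eq_Rintegral => t _; rewrite addrK opprD addrA addrAC.
Qed.

End CompactlySupported.

(** * Local boundedness of weights *)

Section Weights.
Variables (R : realType) (G : topologicalZmodType).
Hypothesis hG : hausdorff_space G.
Hypothesis lcG : locally_compact [set: G].
Variable mu : {measure set (borel G) -> \bar R}.
Hypothesis haar_mu : haar_measure mu.
Variable w : G -> R.
Hypothesis weight_w : weight mu w.

(** The classical proof that a measurable submultiplicative function is locally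
    bounded: for some n the symmetric set where w x and w (- x) are at most n
    meets a compact neighbourhood of 0 in positive measure, and by Steinhaus every
    small v is a difference of two points of that set. *)
Lemma weight_near0 : exists M, \forall v \near (0 : G), w v <= M.
Proof.
have [C C0 wC] := weight_mul weight_w.
have mw := weight_measurable weight_w.
have w0 := weight_gt0 weight_w.
have [V V0 cV] := compact_nbhs0 lcG.
have mV := compact_borel hG cV.
have muV : (0 < mu V)%E.
  apply: lt_le_trans (haar_open_gt0 hG haar_mu (@open_interior _ V) _) _.
    by exists 0.
  by apply: le_measure; rewrite ?inE//;
    [apply: sub_sigma_algebra; exact: open_interior|exact: interior_subset].
pose E n := [set x | V x /\ w x <= n%:R /\ w (- x) <= n%:R].
have mE n : measurable (E n : set (borel G)).
  have mwN : measurable_fun setT ((fun x => w (- x)) : borel G -> R).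
    by apply: (measurableT_comp mw); apply: continuous_borel; exact: opp_continuous.
  have -> : E n = V `&` ((w @^-1` `]-oo, n%:R]) `&`
    ((fun x => w (- x)) @^-1` `]-oo, n%:R])).
    by apply/seteqP; split=> x /=; rewrite !in_itv.
  apply: measurableI => //; apply: measurableI.
    by rewrite -[X in measurable X]setTI; exact: mw.
  by rewrite -[X in measurable X]setTI; exact: mwN.
have [n En] : exists n, (0 < mu (E n))%E.
  apply: contrapT => /forallNP h.
  have E0 k : mu (E k) = 0%E by apply/eqP; rewrite eq_le measure_ge0 andbT leNgt;
    apply/negP; exact: h.
  have VE : V `<=` \bigcup_k E k.
    move=> x Vx; have le0 y : 0 <= w y by exact: ltW.
    exists (Num.bound (w x + w (- x))) => //; split => //.
    by split; apply: ltW; apply: le_lt_trans (archi_boundP _);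
      rewrite ?lerDl ?lerDr ?addr_ge0.
  move: muV; rewrite ltNge => /negP; apply.
  apply: (@le_trans _ _ (mu (\bigcup_k E k))).
    by apply: le_measure; rewrite ?inE//; exact: bigcupT_measurable.
  apply: (le_trans (generalized_Boole_inequality mu mE _)).
    exact: bigcupT_measurable.
  by rewrite eseries0// => k _ _; rewrite E0.
have Enoo : (mu (E n) < +oo)%E.
  apply: le_lt_trans (haar_compact haar_mu cV); apply: le_measure; rewrite ?inE//.
  by move=> x [].
exists (C * n%:R * n%:R); apply: filterS (steinhaus hG haar_mu (mE n) En Enoo) =>
  v [x [_ [_ wx]] [_ [wxv _]]].
have -> : v = (x + v) + - x by rewrite addrAC subrr add0r.
apply: (le_trans (wC _ _)); apply: ler_pM => //;
  rewrite ?mulr_ge0 ?(ltW C0) ?(ltW (w0 _))//.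
by rewrite ler_pM2l.
Qed.

Lemma weight_compact (K : set G) : compact K -> exists2 M, 0 < M & forall x, K x ->
  w x <= M.
Proof.
move=> cK; have [C C0 wC] := weight_mul weight_w; have w0 := weight_gt0 weight_w.
have [M VM] := weight_near0; have [s [_ sK]] := compact_cover_shift cK VM.
have S0 : 0 <= \sum_(a <- s) w a by apply: sumr_ge0 => a _; exact: ltW.
have M0 : 0 <= Num.max M 0 by rewrite le_max lexx orbT.
exists (1 + C * (\sum_(a <- s) w a) * (Num.max M 0)).
  by rewrite ltr_pwDl// !mulr_ge0// (ltW C0).
move=> x /sK[a sa wxa]; rewrite -[x](subrK a) addrC.
apply: (le_trans (wC _ _)); rewrite -[leLHS]add0r lerD//.
apply: ler_pM; rewrite ?mulr_ge0 ?(ltW C0) ?(ltW (w0 _))//.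
  rewrite ler_pM2l// (big_rem a)//= lerDl; apply: sumr_ge0 => b _; exact: ltW.
by rewrite le_max wxa.
Qed.

(** 1 = w (x - x) <= C * w x * w (- x). *)
Lemma weight_inv_compact (K : set G) : compact K ->
  exists2 M, 0 < M & forall x, K x -> (w x)^-1 <= M.
Proof.
move=> cK; have [C C0 wC] := weight_mul weight_w; have w0 := weight_gt0 weight_w.
have cK' : compact (-%R @` K).
  by apply: continuous_compact => //; apply: continuous_subspaceT;
    exact: opp_continuous.
have [M M0 wM] := weight_compact cK'.
exists (C * M); first exact: mulr_gt0.
move=> x Kx; rewrite -[leLHS]mul1r ler_pdivrMr// -(weight_0 weight_w) -(subrr x).
apply: (le_trans (wC _ _)); rewrite mulrAC ler_pM2r// ler_pM2l//.
by apply: wM; exists x.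
Qed.
End Weights.

(** * Young functions and the Orlicz norm *)

Section OrliczNorm.
Variables (R : realType) (G : topologicalZmodType).
Variable mu : {measure set (borel G) -> \bar R}.
Implicit Types (f g v : G -> R[i]^o) (u : G -> R).

Lemma cmeasurable_cplx u : measurable_fun setT (u : borel G -> R) ->
  cmeasurable (cplx u).
Proof. exact: measurable_real_complex. Qed.

Lemma increasing_nneg_fin (Phi : R -> \bar R) x : young Phi ->
  increasing_nneg Phi -> 0 <= x ->
  Phi x \is a fin_num.
Proof.
move=> yP iP x0; rewrite ge0_fin_numE ?(young_ge0 yP)//.
by apply: lt_le_trans (leey (Phi (x + 1))); apply: iP => //; rewrite ltrDl.
Qed.

Lemma increasing_nneg_le (Phi : R -> \bar R) x y : increasing_nneg Phi -> 0 <= x ->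
  x <= y ->
  (Phi x <= Phi y)%E.
Proof. by move=> iP x0; rewrite le_eqVlt => /predU1P[->//|xy]; exact/ltW/iP. Qed.

(** The truncation at 0 makes a globally monotone function out of Phi, whose values
    at negative arguments are arbitrary. *)
Lemma measurable_young (Phi : R -> \bar R) d (T : measurableType d) (r : T -> R) :
  young Phi ->
  increasing_nneg Phi -> measurable_fun setT r -> (forall s, 0 <= r s) ->
  measurable_fun setT (fun s => Phi (r s)).
Proof.
move=> yP iP mr r0; pose phi x := fine (Phi (Num.max x 0)).
have -> : (fun s => Phi (r s)) = EFin \o (phi \o r).
  by apply/funext => s /=; rewrite /phi max_l// fineK// increasing_nneg_fin.
apply/measurable_EFinP; apply: (@measurableT_comp _ _ _ _ _ _ phi) => //.
apply: nondecreasing_measurable => // x y xy; rewrite /phi.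
have h (z : R) : 0 <= Num.max z 0 by rewrite le_max lexx orbT.
apply: fine_le; rewrite ?increasing_nneg_fin//.
apply: increasing_nneg_le => //.
by rewrite ge_max !le_max xy lexx orbT.
Qed.

Lemma measurable_modulusM f v : cmeasurable f -> cmeasurable v ->
  measurable_fun setT ((fun s => (modulus (f s * v s))%:E) : borel G -> \bar R).
Proof.
move=> mf mv; apply/measurable_EFinP.
under eq_fun do rewrite modulusM.
by apply: measurable_funM; exact: measurable_modulus.
Qed.

Lemma orlicz_norm_le Psi f g : cmeasurable f -> cmeasurable g ->
  (forall s, modulus (f s) <= modulus (g s)) ->
  (orlicz_norm mu Psi f <= orlicz_norm mu Psi g)%E.
Proof.
move=> mf mg fg; apply: ge_ereal_sup => _ [v [mv vP] <-].
apply: (@le_trans _ _ (\int[mu]_s (modulus (g s * v s))%:E)%E); last first.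
  by apply: ereal_sup_ubound; exists v.
apply: ge0_le_integral => //.
- by move=> x _; rewrite lee_fin modulus_ge0.
- exact: measurable_modulusM.
- exact: measurable_modulusM.
- by move=> x _; rewrite lee_fin !modulusM ler_wpM2r ?modulus_ge0.
Qed.

Variables (Phi Psi : R -> \bar R).
Hypothesis pair : complementary_pair Phi Psi.
Hypothesis Phi_incr : increasing_nneg Phi.
Hypothesis Psi_incr : increasing_nneg Psi.

Let yPhi : young Phi. Proof. by case: pair. Qed.
Let yPsi : young Psi. Proof. by case: pair. Qed.

Lemma young_inequality x y : 0 <= x -> 0 <= y -> ((x * y)%:E <= Phi x + Psi y)%E.
Proof.
move=> x0 y0; case: pair => _ _ /(_ y y0) ->.
rewrite -leeBlDl ?increasing_nneg_fin//.
by apply: ereal_sup_ubound; exists x.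
Qed.

(** Young's inequality a * |v| <= Phi a + Psi |v|, integrated over B. Choosing a
    large first, it shows that the norm of 1_B tends to 0 with mu B. *)
Lemma orlicz_norm_indic (B : set G) (a : R) : measurable (B : set (borel G)) ->
  0 < a ->
  (a%:E * orlicz_norm mu Psi (cplx (\1_B)) <= Phi a * mu B + 1)%E.
Proof.
move=> mB a0; rewrite -lee_pdivlMl//; apply: ge_ereal_sup => _ [v [mv vP] <-].
rewrite lee_pdivlMl//.
have mv' := measurable_modulus mv.
rewrite -ge0_integralZl_EFin//; last 3 first.
- by move=> x _; rewrite lee_fin modulus_ge0.
- by apply: measurable_modulusM => //; apply: cmeasurable_cplx;
  exact: measurable_indic.
- exact: ltW.
apply: (@le_trans _ _ (\int[mu]_s (Phi a * (\1_B s)%:E + Psi (modulus (v s))))%E).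
  apply: ge0_le_integral => //.
  - by move=> s _; rewrite mule_ge0// lee_fin ?modulus_ge0// ltW.
  - by apply: measurable_funeM; apply: measurable_modulusM => //;
    apply: cmeasurable_cplx; exact: measurable_indic.
  - apply: emeasurable_funD.
      by apply: measurable_funeM; apply/measurable_EFinP; exact: measurable_indic.
    by apply: measurable_young => // s; exact: modulus_ge0.
  move=> s _; rewrite modulusM /cplx modulus_real indicE.
  case: (s \in B) => /=.
    by rewrite normr1 mul1r -EFinM mule1; apply: young_inequality;
      rewrite ?modulus_ge0// ltW.
  by rewrite normr0 mul0r !mule0 add0e (young_ge0 yPsi)// modulus_ge0.
rewrite ge0_integralD//; last 4 first.
- by move=> s _; rewrite mule_ge0 ?lee_fin// (young_ge0 yPhi)// ltW.
- by apply: measurable_funeM; apply/measurable_EFinP; exact: measurable_indic.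
- by move=> s _; rewrite (young_ge0 yPsi)// modulus_ge0.
- by apply: measurable_young => // s; exact: modulus_ge0.
apply: leeD => //.
rewrite ge0_integralZl//; last 2 first.
- by apply/measurable_EFinP; exact: measurable_indic.
- by rewrite (young_ge0 yPhi)// ltW.
by rewrite integral_indic// setIT.
Qed.

Lemma LPhi_bounded u M (B : set G) : measurable (B : set (borel G)) ->
  (mu B < +oo)%E ->
  measurable_fun setT (u : borel G -> R) -> (forall s, `|u s| <= M) ->
    (forall s, ~ B s -> u s = 0) ->
  LPhi mu Phi (cplx u).
Proof.
move=> mB Boo mu_ uM u0; split; first exact: cmeasurable_cplx.
have M0 : 0 <= M by apply: le_trans (uM 0).
exists 1 => //.
apply: (@le_lt_trans _ _ (\int[mu]_s (Phi M * (\1_B s)%:E))%E).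
  apply: ge0_le_integral => //.
  - by move=> s _; rewrite (young_ge0 yPhi)// mul1r modulus_ge0.
  - apply: measurable_young => //.
      by apply: measurable_funM => //; apply: measurable_modulus;
        exact: cmeasurable_cplx.
    by move=> s; rewrite mul1r modulus_ge0.
  - by apply: measurable_funeM; apply/measurable_EFinP; exact: measurable_indic.
  move=> s _; rewrite mul1r /cplx modulus_real indicE.
  have [sB|sB] := boolP (s \in B); first by rewrite mule1 increasing_nneg_le.
  rewrite u0 ?normr0 ?(young_at0 yPhi) ?mule0//.
  by move=> Bs; move/negP: sB; apply; rewrite inE.
rewrite ge0_integralZl//; last 2 first.
- by apply/measurable_EFinP; exact: measurable_indic.
- by rewrite (young_ge0 yPhi).
rewrite integral_indic// setIT.
have fB : mu B \is a fin_num by rewrite ge0_fin_numE.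
by rewrite -(fineK fB) -(fineK (increasing_nneg_fin yPhi Phi_incr M0)) -EFinM ltry.
Qed.

(** Chebyshev's inequality: Phi (al * |c|) * mu B is at most the integral of
    Phi (al * |f|), and Phi (al * |c|) > 0 by strict monotonicity. *)
Lemma LPhi_level f c : LPhi mu Phi f -> c != 0 ->
  measurable (f @^-1` [set c] : set (borel G)) ->
  (mu (f @^-1` [set c]) < +oo)%E.
Proof.
move=> [mf [al al0 foo]] c0 mB; set B := _ @^-1` _ in mB *.
have c0' : 0 < modulus c.
  by rewrite lt0r modulus_ge0 andbT; apply: contra c0 => /eqP/modulus_eq0 ->.
have P0 : (0 < Phi (al * modulus c))%E.
  by rewrite -(young_at0 yPhi); apply: Phi_incr => //; exact: mulr_gt0.
have : (\int[mu]_s (Phi (al * modulus c)%R * (\1_B s)%:E) < +oo)%E.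
  apply: le_lt_trans foo; apply: ge0_le_integral => //.
  - by move=> s _; rewrite mule_ge0 ?lee_fin// ltW.
  - by apply: measurable_funeM; apply/measurable_EFinP; exact: measurable_indic.
  - apply: measurable_young => //.
      by apply: measurable_funM => //; exact: measurable_modulus.
    by move=> s; rewrite mulr_ge0 ?modulus_ge0// ltW.
  move=> s _; rewrite indicE; have [sB|sB] := boolP (s \in B).
    by move: sB; rewrite inE /B /= => ->; rewrite mule1.
  by rewrite mule0 (young_ge0 yPhi)// mulr_ge0 ?modulus_ge0// ltW.
rewrite ge0_integralZl//; last 2 first.
- by apply/measurable_EFinP; exact: measurable_indic.
- exact: ltW.
rewrite integral_indic// setIT; apply: contraTT;
  rewrite -!leNgt !leye_eq => /eqP ->.
by rewrite gt0_muley.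
Qed.

End OrliczNorm.

(** * The weighted algebra *)

Section WeightedAlgebra.
Variables (R : realType) (G : topologicalZmodType).
Hypothesis hG : hausdorff_space G.
Hypothesis lcG : locally_compact [set: G].
Variable mu : {measure set (borel G) -> \bar R}.
Hypothesis haar_mu : haar_measure mu.
Variable w : G -> R.
Hypothesis weight_w : weight mu w.
Variables (Phi Psi : R -> \bar R).
Hypothesis pair : complementary_pair Phi Psi.
Hypothesis Phi_incr : increasing_nneg Phi.
Hypothesis Psi_incr : increasing_nneg Psi.
Hypothesis alg : banach_algebra (LPhiw mu Phi Psi w).
Implicit Types (f g h : G -> R[i]^o) (u v : G -> R) (a : R[i]).

Definition wL f := LPhi mu Phi (weighted w f).
Definition wS f := SPhi mu Phi Psi (weighted w f).
(** The norm is extended-real valued, but finite on the algebra; its real value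
    allows the usual arithmetic in estimates. *)
Definition nrm f : R := fine (weighted_norm mu Psi w f).

Lemma wL_lin a f g : wL f -> wL g -> wL (a *: f + g).
Proof. exact: (ba_lin alg). Qed.
Lemma wL0 : wL 0. Proof. exact: (ba_0 alg). Qed.
Lemma wLZ a f : wL f -> wL (a *: f).
Proof. by move=> Lf; rewrite -[_ *: f]addr0; apply: wL_lin => //; exact: wL0. Qed.
Lemma wLD f g : wL f -> wL g -> wL (f + g).
Proof. by move=> Lf Lg; rewrite -[f]scale1r; exact: wL_lin. Qed.
Lemma wLB f g : wL f -> wL g -> wL (f - g).
Proof. by move=> Lf Lg; rewrite addrC -scaleN1r; exact: wL_lin. Qed.

Lemma nrmE f : wL f -> weighted_norm mu Psi w f = (nrm f)%:E.
Proof.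
move=> Lf; rewrite /nrm fineK// ge0_fin_numE; first exact: (ba_norm_fin alg).
exact: (ba_norm_ge0 alg).
Qed.

Lemma nrm_ge0 f : wL f -> 0 <= nrm f.
Proof. by move=> Lf; rewrite -lee_fin -nrmE//; exact: (ba_norm_ge0 alg). Qed.

Lemma nrmZ a f : wL f -> nrm (a *: f) = modulus a * nrm f.
Proof.
move=> Lf; apply: EFin_inj; rewrite -nrmE; last exact: wLZ.
by rewrite EFinM -nrmE//; exact: (ba_normZ alg).
Qed.

Lemma nrmD f g : wL f -> wL g -> nrm (f + g) <= nrm f + nrm g.
Proof.
move=> Lf Lg; rewrite -lee_fin EFinD -!nrmE//; first exact: (ba_normD alg).
exact: wLD.
Qed.

Lemma nrmN f : wL f -> nrm (- f) = nrm f.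
Proof. by move=> Lf; rewrite -scaleN1r nrmZ// modulusN /modulus
  ComplexField.Normc.normc1 mul1r. Qed.

Lemma nrmBC f g : wL f -> wL g -> nrm (f - g) = nrm (g - f).
Proof. by move=> Lf Lg; rewrite -opprB nrmN//; exact: wLB. Qed.

Lemma nrm_tri f g h : wL f -> wL g -> wL h ->
  nrm (f - h) <= nrm (f - g) + nrm (g - h).
Proof.
move=> Lf Lg Lh; have -> : f - h = (f - g) + (g - h) by rewrite addrA subrK.
by apply: nrmD; exact: wLB.
Qed.

Lemma nrm_ae f : wL f -> nrm f = 0 <-> ae_zero mu f.
Proof.
move=> Lf; split=> h.
  by apply/(ba_norm_eq0 alg Lf); rewrite [anorm _]nrmE// h.
by apply: EFin_inj; rewrite -nrmE//; exact/(ba_norm_eq0 alg Lf).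
Qed.

Lemma nrm_le f g k : 0 <= k -> wL f -> wL g ->
  (forall s, modulus (f s) <= k * modulus (g s)) ->
  nrm f <= k * nrm g.
Proof.
move=> k0 Lf Lg fg.
have -> : k * nrm g = nrm (k%:C *: g) by rewrite nrmZ// modulus_real ger0_norm.
have Lk := wLZ k%:C Lg.
rewrite -lee_fin -!nrmE//; apply: orlicz_norm_le; [by case: Lf|by case: Lk|].
move=> s; rewrite /weighted (_ : (k%:C *: g) s = k%:C * g s)// !modulusM
  !modulus_real.
by rewrite (ger0_norm k0) ler_wpM2r.
Qed.

Lemma w_gt0 s : 0 < w s. Proof. exact: weight_gt0 weight_w s. Qed.
Lemma w_neq0 s : (w s)%:C != 0. Proof. by apply/eqP => -[] /eqP;
  rewrite gt_eqF// w_gt0. Qed.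
Lemma measurable_w : measurable_fun setT (w : borel G -> R).
Proof. exact: weight_measurable weight_w. Qed.
Lemma measurable_winv : measurable_fun setT ((fun s => (w s)^-1) : borel G -> R).
Proof.
have [/measurable_modulus + _] := weight_inv weight_w.
by under eq_fun do rewrite modulus_real ger0_norm ?invr_ge0 ?(ltW (w_gt0 _))//.
Qed.

Lemma weighted_cplx u : weighted w (cplx u) = cplx (fun s => u s * w s).
Proof. by apply/funext => s; rewrite /weighted /cplx rmorphM. Qed.

Lemma cplxB u v : cplx u - cplx v = cplx (fun s => u s - v s).
Proof. by apply/funext => s; rewrite /cplx !fctE rmorphB. Qed.
Lemma modulus_cplx u s : modulus (cplx u s) = `|u s|.
Proof. exact: modulus_real. Qed.

Lemma weightedB f g : weighted w (f - g) = weighted w f - weighted w g.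
Proof. by apply/funext => s; rewrite /weighted !fctE mulrBl. Qed.

Lemma weighted_lin a f g : weighted w (a *: f + g) = a *:
  weighted w f + weighted w g.
Proof. by apply/funext => s; rewrite /weighted !fctE mulrDl scalerAl. Qed.

Definition unw f : G -> R[i]^o := fun s => f s / (w s)%:C.
Lemma weighted_unw f : weighted w (unw f) = f.
Proof. by apply/funext => s; rewrite /weighted /unw divfK// w_neq0. Qed.

Definition wSt f := step_function (weighted w f) /\ wL f.

(** Describes the closure of the step functions inside the weighted space, where
    the step functions divided by w play their role. *)
Lemma wSP f : wS f <-> wL f /\ forall e, 0 < e ->
  exists2 g, wSt g & nrm (f - g) < e.
Proof.
split=> -[Lf hf]; split=> // e e0.
  have [g [sg Lg fg]] := hf e e0.
  have Lg' : wL (unw g) by rewrite /wL weighted_unw.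
  exists (unw g); first by split => //; rewrite weighted_unw.
  by rewrite -lte_fin -nrmE; [rewrite /weighted_norm weightedB weighted_unw|exact:
    wLB].
have [g [sg Lg] fg] := hf e e0.
exists (weighted w g); split => //.
by move: fg; rewrite -lte_fin -nrmE; [rewrite /weighted_norm weightedB|exact: wLB].
Qed.

Lemma wS_L f : wS f -> wL f. Proof. by case/wSP. Qed.

Lemma measurable_set1 (z : R[i]^o) : measurable ([set z] : set (borel R[i]^o)).
Proof.
rewrite -(setCK [set z]); apply: measurableC; apply: sub_sigma_algebra.
by apply: closed_openC; apply: accessible_closed_set1;
  exact/hausdorff_accessible/norm_hausdorff.
Qed.

Lemma measurable_level f (c : R[i]^o) : cmeasurable f ->
  measurable (f @^-1` [set c] : set (borel G)).
Proof. by move=> mf; rewrite -[X in measurable X]setTI; apply: mf => //;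
  exact: measurable_set1. Qed.

(** The two ranges being finite, the preimage of a Borel set under the combination
    is a finite union of intersections of level sets of f and g. *)
Lemma step_function_lin a f g : step_function f -> step_function g ->
  step_function (a *: f + g).
Proof.
move=> [mf ff] [mg fg]; split; last first.
  apply: (@sub_finite_set _ _ [set a *: x + y | x in range f & y in range g]).
    by move=> _ [s _ <-]; exists (f s); [exists s|exists (g s); [exists s|]].
  exact: finite_image2.
move=> _ B mB; rewrite setTI.
have -> : (a *: f + g) @^-1` B =
    \bigcup_(p in [set p : R[i]^o * R[i]^o | (range f p.1 /\ range g p.2) /\
      B (a *: p.1 + p.2)])
      ((f @^-1` [set p.1]) `&` (g @^-1` [set p.2])).
  apply/seteqP; split=> s /=.
    by move=> Bs; exists (f s, g s) => //=; split; [split; exists s|exact: Bs].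
  by move=> [[x y] /= [_ Bxy] [fx gy]]; rewrite !fctE fx gy.
apply: fin_bigcup_measurable.
  apply: (@sub_finite_set _ _ (range f `*` range g)); first by move=> p [].
  exact: finite_setX.
by move=> p _; apply: measurableI; exact: measurable_level.
Qed.

Lemma wSt_lin a f g : wSt f -> wSt g -> wSt (a *: f + g).
Proof.
move=> [sf Lf] [sg Lg]; split; last exact: wL_lin.
by rewrite weighted_lin; exact: step_function_lin.
Qed.

Lemma wS_lin a f g : wS f -> wS g -> wS (a *: f + g).
Proof.
move=> /wSP[Lf hf] /wSP[Lg hg]; apply/wSP; split; first exact: wL_lin.
move=> e e0; have d0 : 0 < e / 2 / (modulus a + 1).
  by rewrite !divr_gt0// ltr_wpDl ?modulus_ge0.
have [f' sf' ff'] := hf _ d0.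
have [g' sg' gg'] := hg (e / 2) (divr_gt0 e0 (ltr0Sn R 1)).
exists (a *: f' + g'); first exact: wSt_lin.
have Lf' : wL f' by case: sf'. have Lg' : wL g' by case: sg'.
have -> : a *: f + g - (a *: f' + g') = a *: (f - f') + (g - g').
  by rewrite scalerBr opprD addrACA.
apply: (le_lt_trans (nrmD _ _)); [by apply: wLZ; exact: wLB|exact: wLB|].
rewrite nrmZ; last exact: wLB.
rewrite [e in _ < e](splitr e); apply: ler_ltD => //.
apply: (@le_trans _ _ ((modulus a + 1) * (e / 2 / (modulus a + 1)))).
  by apply: ler_pM; rewrite ?modulus_ge0 ?nrm_ge0 ?lerDl ?ltW//; exact: wLB.
by rewrite mulrC divfK// gt_eqF// ltr_wpDl ?modulus_ge0.
Qed.

Lemma wSB f g : wS f -> wS g -> wS (f - g).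
Proof. by move=> Sf Sg; rewrite addrC -scaleN1r; exact: wS_lin. Qed.

Lemma wS_closed f : wL f -> (forall e, 0 < e -> exists2 g, wS g & nrm (f - g) < e)
  -> wS f.
Proof.
move=> Lf hf; apply/wSP; split => // e e0; have e20 := divr_gt0 e0 (ltr0Sn R 1).
have [g Sg fg] := hf _ e20.
have /wSP[Lg /(_ _ e20)[h sh gh]] := Sg.
exists h => //; have Lh : wL h by case: sh.
apply: (le_lt_trans (nrm_tri Lf Lg Lh)).
by rewrite [e in _ < e](splitr e); exact: ltrD.
Qed.

Lemma wSt_S f : wSt f -> wS f.
Proof.
move=> sf; apply/wSP; split; first by case: sf.
by move=> e e0; exists f => //; rewrite subrr (nrm_ae _).2//;
  [exact: wL0|exact: aeW].
Qed.

Lemma wS0 : wS 0.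
Proof.
apply: wSt_S; split; last exact: wL0.
have -> : weighted w 0 = cst 0 by apply/funext => s; rewrite /weighted fctE mul0r.
split; first exact: measurable_cst.
by apply: (@sub_finite_set _ _ [set 0]) => // _ [s _ <-].
Qed.

Lemma wL_bounded u M (B : set G) : measurable (B : set (borel G)) ->
  (mu B < +oo)%E ->
  measurable_fun setT (u : borel G -> R) -> (forall s, `|u s * w s| <= M) ->
    (forall s, ~ B s -> u s = 0) ->
  wL (cplx u).
Proof.
move=> mB Boo mu_ uM u0; rewrite /wL weighted_cplx.
apply: (@LPhi_bounded _ _ _ _ _ pair _ _ M B) => //.
  by apply: measurable_funM => //; exact: measurable_w.
by move=> s nB; rewrite u0// mul0r.
Qed.

Lemma Bc_weighted u : Bc u -> Bc (fun s => u s * w s).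
Proof.
move=> [mu_ [M uM] [K cK uK]]; split.
- by apply: measurable_funM => //; exact: measurable_w.
- have [W W0 wW] := weight_compact hG lcG haar_mu weight_w cK.
  exists (M * W) => s; have [Ks|nKs] := pselect (K s); last first.
    by rewrite uK// mul0r normr0 mulr_ge0// ?(ltW W0)//; exact: le_trans (uM 0).
  by rewrite normrM ler_pM// ger0_norm ?wW// ltW// w_gt0.
by exists K => // s nK; rewrite uK// mul0r.
Qed.

Lemma Bc_unweighted u : Bc u -> Bc (fun s => u s / w s).
Proof.
move=> [mu_ [M uM] [K cK uK]]; split.
- by apply: measurable_funM => //; exact: measurable_winv.
- have [W W0 wW] := weight_inv_compact hG lcG haar_mu weight_w cK.
  exists (M * W) => s; have [Ks|nKs] := pselect (K s); last first.
    by rewrite uK// mul0r normr0 mulr_ge0// ?(ltW W0)//; exact: le_trans (uM 0).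
  by rewrite normrM ler_pM// ger0_norm ?wW// invr_ge0 ltW// w_gt0.
by exists K => // s nK; rewrite uK// mul0r.
Qed.

Lemma Bc_wL u : Bc u -> wL (cplx u).
Proof.
move=> nu; have [_ [M uM] _] := Bc_weighted nu.
case: (nu) => mu_ _ [K cK uK].
by apply: (@wL_bounded u M K) => //;
  [exact: compact_borel|exact: haar_compact haar_mu _ cK].
Qed.

(** u' is u rounded down to a multiple of e. *)
Lemma Bc_simple_approx u e : Bc u -> 0 < e ->
  exists u', [/\ Bc u', finite_set (range u') &
  forall s, `|u s - u' s| <= e /\ (u s = 0 -> u' s = 0)].
Proof.
move=> [mu_ [M uM] [K cK uK]] e0; have M0 : 0 <= M := le_trans (normr_ge0 _) (uM 0).
pose u' s := e * (Num.floor (u s / e))%:~R.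
have uu' s : `|u s - u' s| <= e.
  have := floor_itv (u s / e); rewrite /u' => /andP[h1 h2].
  have -> : u s - e * (Num.floor (u s / e))%:~R =
    e * (u s / e - (Num.floor (u s / e))%:~R).
    by rewrite mulrBr [e * (_ / e)]mulrC divfK// gt_eqF.
  rewrite normrM (gtr0_norm e0).
  rewrite -[leRHS]mulr1 ler_pM2l// ger0_norm ?subr_ge0// lerBlDl.
  by move: h2; rewrite intrD => /ltW.
have u'0 s : u s = 0 -> u' s = 0 by rewrite /u' => ->; rewrite mul0r floor0 mulr0.
exists u'; split; last (by move=> s; split; [exact: uu'|exact: u'0]); first split.
- apply: measurable_funM => //.
  apply: (@measurableT_comp _ _ _ _ _ _ (fun z : R => (Num.floor z)%:~R : R)).
    by apply: nondecreasing_measurable => // x y xy; rewrite ler_int;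
      exact: le_floor.
  exact: measurable_funM.
- exists (M + e) => s; rewrite -[u' s](subKr (u s));
  apply: (le_trans (ler_normB _ _)).
  exact: lerD.
- by exists K => // s nK; apply: u'0; exact: uK.
pose N := Num.bound (M / e).
apply: (@sub_finite_set _ _ ((fun n : nat => e * ((n : int) - (N.+1 : int))%:~R) @`
  `I_(N.*2.+2))); last first.
  exact/finite_image/finite_II.
move=> _ [s _ <-].
have : `|u s / e| < N%:R.
  apply: le_lt_trans (archi_boundP _); last by rewrite divr_ge0// ltW.
  by rewrite normrM normfV (gtr0_norm e0) ler_pM2r ?invr_gt0.
rewrite ltr_norml => /andP[h1 h2].
have l1 : - (N.+1 : int) <= Num.floor (u s / e).
  rewrite floor_ge_int; apply: le_trans (ltW h1).
  by rewrite mulrNz lerN2 ler_nat.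
have l2 : Num.floor (u s / e) < N.
  by rewrite floor_lt_int.
exists (absz (Num.floor (u s / e) + (N.+1 : int))); last first.
  by rewrite /u' gez0_abs ?addrK//; lia.
by rewrite /=; lia.
Qed.

Lemma Bc_wS u : Bc u -> wS (cplx u).
Proof.
move=> nu; have Lu := Bc_wL nu; apply: wS_closed => // e e0.
have nuw := Bc_weighted nu.
have [_ _ [K cK uK]] := nu.
have n1 : Bc (fun s => \1_K s / w s).
  by apply: Bc_unweighted; apply: (@Bc_indic _ _ _ K) => //; exact: compact_borel.
have L1 := Bc_wL n1; have N0 := nrm_ge0 L1.
set N := nrm _ in N0.
have d0 : 0 < e / (N + 1) by rewrite divr_gt0// ltr_wpDl.
have [u' [nu' fu' uu']] := Bc_simple_approx nuw d0.
have nu'' := Bc_unweighted nu'.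
exists (cplx (fun s => u' s / w s)).
  apply: wSt_S; split; last exact: Bc_wL.
  rewrite weighted_cplx (_ : (fun s => _) = u'); last first.
    by apply/funext => s; rewrite divfK// gt_eqF// w_gt0.
  split; first by apply: cmeasurable_cplx; case: nu'.
  have -> : range (cplx u') = (fun r : R => (r%:C : R[i]^o)) @` range u'.
    by rewrite image_comp.
  exact: finite_image.
apply: (@le_lt_trans _ _ (e / (N + 1) * N)); last first.
  by rewrite mulrAC ltr_pdivrMr ?ltr_wpDl// mulrDr mulr1 ltrDl.
apply: nrm_le => //; [exact: ltW|by apply: wLB => //; exact: Bc_wL|].
move=> s; rewrite cplxB !modulus_cplx.
have [Ks|nKs] := pselect (K s); last first.
  have us := uK s nKs; rewrite us (uu' s).2 ?us ?mul0r// subrr normr0.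
  by apply: mulr_ge0 => //; exact: ltW.
rewrite indicE mem_set//= mul1r.
rewrite -[u s](mulfK (lt0r_neq0 (w_gt0 s))) -mulrBl !normrM.
by rewrite ler_wpM2r// (uu' s).1.
Qed.

(** Uniform smallness on a fixed compact set is smallness in the algebra. The
    approximations of convolutions by translates below are all of this kind. *)
Lemma nrm_le_compact u e (K : set G) : 0 <= e -> wL (cplx u) -> compact K ->
  (forall s, ~ K s -> u s = 0) ->
  (forall s, `|u s| <= e) -> nrm (cplx u) <= e * nrm (cplx \1_K).
Proof.
move=> e0 Lu cK uK ue.
have nK : Bc (\1_K : G -> R) by apply: (@Bc_indic _ _ _ K) => //;
  exact: compact_borel.
apply: nrm_le => //; first exact: Bc_wL.
move=> s; rewrite !modulus_cplx indicE.
have [Ks|nKs] := pselect (K s); last by rewrite uK// normr0 mulr_ge0.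
by rewrite mem_set// normr1 mulr1.
Qed.

Let yPhi : young Phi. Proof. by case: pair. Qed.

(** * Density of compactly supported functions *)

Lemma unw_indic_wL (B : set G) : measurable (B : set (borel G)) -> (mu B < +oo)%E ->
  wL (cplx (fun s => \1_B s / w s)).
Proof.
move=> mB Boo; apply: (wL_bounded (M := 1) mB Boo).
- by apply: measurable_funM; [exact: measurable_indic|exact: measurable_winv].
- move=> s; rewrite divfK ?gt_eqF ?w_gt0// indicE; case: (_ \in _);
  by rewrite ?normr1 ?normr0.
- by move=> s nB; rewrite indicE memNset// mul0r.
Qed.

Lemma unw_indic_wS (B : set G) : measurable (B : set (borel G)) -> (mu B < +oo)%E ->
  wS (cplx (fun s => \1_B s / w s)).
Proof.
move=> mB Boo; apply: wSt_S; split; last exact: unw_indic_wL.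
rewrite weighted_cplx; have -> : (fun s => \1_B s / w s * w s) = \1_B.
  by apply/funext => s; rewrite divfK ?gt_eqF ?w_gt0.
split; first by apply: cmeasurable_cplx; exact: measurable_indic.
apply: (@sub_finite_set _ _ [set 0; 1]); last by rewrite finite_setU.
by move=> _ [s _ <-]; rewrite /cplx indicE; case: (_ \in _); [right|left].
Qed.

Lemma unw_indic_small e : 0 < e -> exists2 d, 0 < d &
  forall B : set G, measurable (B : set (borel G)) -> (mu B < d%:E)%E ->
  nrm (cplx (fun s => \1_B s / w s)) <= e.
Proof.
(* The value of a makes the term 1 / a of orlicz_norm_indic equal to e / 2, and
   that of d bounds the term Phi a * mu B / a by e / 2. *)
move=> e0; pose a := 2 / e; have a0 : 0 < a by rewrite divr_gt0.
have pa := increasing_nneg_fin yPhi Phi_incr (ltW a0).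
have pa0 : 0 <= fine (Phi a) by rewrite fine_ge0// (young_ge0 yPhi)// ltW.
exists (fine (Phi a) + 1)^-1; first by rewrite invr_gt0 ltr_wpDl.
move=> B mB Bd; have Boo : (mu B < +oo)%E by apply: (lt_trans Bd); rewrite ltry.
have Bfin : mu B \is a fin_num by rewrite ge0_fin_numE.
have := orlicz_norm_indic mu pair Phi_incr Psi_incr mB a0.
have -> : orlicz_norm mu Psi (cplx \1_B) = (nrm (cplx (fun s => \1_B s / w s)))%:E.
  rewrite -(nrmE (unw_indic_wL mB Boo)) /weighted_norm weighted_cplx;
    congr (orlicz_norm _ _ (cplx _)).
  by apply/funext => s; rewrite divfK ?gt_eqF ?w_gt0.
rewrite -(fineK pa) -(fineK Bfin) -!EFinM -EFinD lee_fin => h.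
rewrite -(ler_pM2l a0); apply: (le_trans h).
rewrite /a divfK ?gt_eqF ?w_gt0// -[leRHS]/(1 + 1) lerD2r.
apply: (@le_trans _ _ ((fine (Phi a) + 1) * (fine (Phi a) + 1)^-1)).
  apply: ler_pM => //.
    by rewrite lerDl.
  by move: Bd; rewrite -{1}(fineK Bfin) lte_fin => /ltW.
by rewrite divff// gt_eqF// ltr_wpDl.
Qed.

Section Induction.
Variable P : (G -> R[i]^o) -> Prop.
Hypothesis PCc : forall u, Cc u -> P (cplx u).
Hypothesis Plin : forall a f g, wS f -> wS g -> P f -> P g -> P (a *: f + g).
Hypothesis Plim : forall f, wS f ->
  (forall e, 0 < e -> exists g, [/\ wS g, P g & nrm (f - g) < e]) -> P f.

Lemma density0 : P 0.
Proof.
have -> : 0 = cplx (fun=> 0) :> (G -> R[i]^o) by [].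
apply: PCc; split; first by move=> x; exact: cvg_cst.
by exists set0 => //; exact: compact0.
Qed.

Lemma density_sum (r : seq R[i]) (F : R[i] -> G -> R[i]^o) :
  (forall c, c != 0 -> wS (F c) /\ P (F c)) ->
  wS (\sum_(c <- r | c != 0) c *: F c) /\ P (\sum_(c <- r | c != 0) c *: F c).
Proof.
move=> h; elim: r => [|c r [IH1 IH2]].
  by rewrite big_nil; split; [exact: wS0|exact: density0].
rewrite big_cons; case: ifPn => // /h[h1 h2].
by split; [exact: wS_lin|exact: Plin].
Qed.

(** The value 0 is left out because its level set may have infinite measure. *)
Lemma level_sum g : finite_set (range g) -> exists r : seq R[i],
  forall s, g s = \sum_(c <- r | c != 0) c * (\1_(g @^-1` [set c]) s)%:C.
Proof.
move=> /finite_seqP[r rE]; exists (undup r) => s.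
have gr : g s \in undup r.
  by rewrite mem_undup; have : range g (g s) by [exists s]; rewrite rE.
have [g0|g0] := eqVneq (g s) 0.
  rewrite big1 => [//|c c0]; rewrite indicE memNset ?mulr0//=.
  by rewrite g0 => c0'; move/eqP: c0; apply.
rewrite big_mkcond (bigD1_seq (g s))//= ?undup_uniq//.
rewrite g0 indicE mem_set//= mulr1 big1 ?addr0// => c cg.
case: ifP => // _; rewrite indicE memNset ?mulr0//=.
by move=> gc; move/eqP: cg; apply.
Qed.

(** A Urysohn function between compact and open approximations of B differs from
    1_B on a set of small measure only. *)
Lemma density_indic (B K : set G) : measurable (B : set (borel G)) -> compact K ->
  B `<=` K ->
  P (cplx \1_B).
Proof.
move=> mB cK BK; have nB := @Bc_indic R _ _ _ mB cK BK.
apply: Plim; first exact: Bc_wS.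
move=> e e0.
have [K' cK' KK'] := compact_enlarge lcG cK.
have [M M0 wM] := weight_compact hG lcG haar_mu weight_w cK'.
have [d d0 small] := unw_indic_small (divr_gt0 (divr_gt0 e0 (ltr0Sn R 1)) M0).
have mK := compact_borel hG cK; have mK' := compact_borel hG cK'.
have Boo : (mu B < +oo)%E.
  by apply: le_lt_trans (haar_compact haar_mu cK); rewrite le_measure ?inE.
have [K1 [U [[cK1 oU BU KU] Uoo UB UK1]]] :=
  haar_approx hG haar_mu mB Boo (divr_gt0 d0 (ltr0Sn R 1)).
have mK1 := compact_borel hG cK1.
have mU : measurable (U : set (borel G)) by exact: sub_sigma_algebra.
have [phi [cphi phi01 phi1 phi0]] :=
  @compact_urysohn _ hG lcG R (K1 `&` K) (U `&` K'°)
  (compact_closedI cK1 (compact_closed hG cK)) (openI oU (@open_interior _ K'))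
    (setISS KU KK').
have Cphi : Cc phi.
  split => //; exists K' => // s nK; apply: phi0 => -[_ /interior_subset];
    exact: nK.
exists (cplx phi); split; [exact/Bc_wS/Cc_Bc|exact: PCc|].
(* 1_B and phi differ by at most 1, and only on the small set E, which lies in a
   compact set, where w is bounded. *)
pose E := ((U `\` B) `|` (U `\` K1)) `&` K'.
have mE : measurable (E : set (borel G)).
  by apply: measurableI => //; apply: measurableU; exact: measurableD.
have mEd : (mu E < d%:E)%E.
  apply: (@le_lt_trans _ _ (mu (U `\` B) + mu (U `\` K1))%E).
    apply: (@le_trans _ _ (mu ((U `\` B) `|` (U `\` K1)))).
      rewrite le_measure ?inE//; last exact: subIsetl.
      by apply: measurableU; exact: measurableD.
    exact: (measureU2 mu (measurableD mU mB) (measurableD mU mK1)).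
  by rewrite [d]splitr EFinD; exact: lteD.
have Eoo : (mu E < +oo)%E by apply: (lt_trans mEd); rewrite ltry.
have LE := unw_indic_wL mE Eoo.
apply: (@le_lt_trans _ _ (M * nrm (cplx (fun s => \1_E s / w s)))); last first.
  apply: (@le_lt_trans _ _ (M * (e / 2 / M))).
    by rewrite ler_pM2l//; exact: small.
  by rewrite mulrC divfK ?gt_eqF ?w_gt0// [ltRHS]splitr ltrDl divr_gt0.
apply: nrm_le => //; first exact: ltW.
  by apply: wLB; apply: Bc_wL => //; exact: Cc_Bc.
move=> s; rewrite cplxB !modulus_cplx /=.
have [Es|nEs] := pselect (E s).
  have -> : (\1_E s : R) = 1 by rewrite indicE mem_set.
  rewrite mul1r [X in _ <= _ * X]ger0_norm ?invr_ge0 ?(ltW (w_gt0 _))//.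
  apply: (@le_trans _ _ 1).
    have /andP[p0 p1] := phi01 s.
    rewrite ler_norml indicE; case: (_ \in _) => /=; apply/andP; split; lra.
  by rewrite ler_pdivlMr ?w_gt0// mul1r; apply: wM; case: Es.
rewrite (_ : \1_B s = phi s) ?subrr ?normr0.
  by rewrite mulr_ge0 ?(ltW M0).
rewrite indicE; have [Bs|nBs] := pselect (B s).
  rewrite mem_set// phi1//; split; last exact: BK.
  apply: contrapT => nK1; apply: nEs; split;
    last exact: (interior_subset (KK' _ (BK _ Bs))).
  by right; split => //; exact: BU.
rewrite memNset//= phi0// => -[Us /interior_subset K's].
by apply: nEs; split => //; left.
Qed.

(** Round u to finitely many values; the level sets of the nonzero ones lie in the
    support of u. *)
Lemma density_Bc u : Bc u -> P (cplx u).
Proof.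
move=> nu; have [_ _ [K cK uK]] := nu.
apply: Plim; first exact: Bc_wS.
move=> e e0.
have n1 : Bc (\1_K : G -> R) by apply: (@Bc_indic _ _ _ K) => //;
  exact: compact_borel.
set N := nrm (cplx \1_K); have N0 : 0 <= N by apply: nrm_ge0; exact: Bc_wL.
have d0 : 0 < e / (N + 1) by rewrite divr_gt0// ltr_wpDl.
have [u' [nu' fu' uu']] := Bc_simple_approx nu d0.
have u'K s : ~ K s -> u' s = 0 by move=> nK; apply: (uu' s).2; exact: uK.
exists (cplx u'); split; first exact: Bc_wS.
  have fr : finite_set (range (cplx u')).
    have -> : range (cplx u') =
      (fun r : R => (r%:C : R[i]^o)) @` range u' by rewrite image_comp.
    exact: finite_image.
  have [r rE] := level_sum fr.
  pose F c : G -> R[i]^o := cplx (\1_(cplx u' @^-1` [set c])).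
  have -> : cplx u' = \sum_(c <- r | c != 0) c *: F c.
    by apply/funext => s; rewrite fct_sumE rE.
  apply: (density_sum r (F := F) _).2 => c c0.
  have mB : measurable ((cplx u' @^-1` [set c]) : set (borel G)).
    by apply: measurable_level; apply: cmeasurable_cplx; case: nu'.
  have BK : cplx u' @^-1` [set c] `<=` K.
    move=> s /= us; apply: contrapT => /u'K u's; move/eqP: c0; apply.
    by rewrite -us /cplx u's.
  split; last exact: density_indic mB cK BK.
  by apply: Bc_wS; exact: Bc_indic mB cK BK.
apply: (@le_lt_trans _ _ (e / (N + 1) * N)); last first.
  by rewrite mulrAC ltr_pdivrMr ?ltr_wpDl// mulrDr mulr1 ltrDl.
rewrite cplxB; apply: nrm_le_compact => //.
- exact: ltW.
- by rewrite -cplxB; apply: wLB; exact: Bc_wL.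
- by move=> s nK; rewrite uK// u'K// subrr.
- by move=> s; exact: (uu' s).1.
Qed.

(** Up to a set of small measure B is contained in a compact set. *)
Lemma density_unw_indic (B : set G) : measurable (B : set (borel G)) ->
  (mu B < +oo)%E ->
  P (cplx (fun s => \1_B s / w s)).
Proof.
move=> mB Boo; apply: Plim; first exact: unw_indic_wS.
move=> e e0; have [d d0 small] := unw_indic_small (divr_gt0 e0 (ltr0Sn R 1)).
have [K [U [[cK oU BU KU] Uoo UB UK]]] := haar_approx hG haar_mu mB Boo d0.
have mK := compact_borel hG cK.
have mU : measurable (U : set (borel G)) by exact: sub_sigma_algebra.
have mBK : measurable (B `&` K : set (borel G)) by exact: measurableI.
have n1 : Bc (fun s => \1_(B `&` K) s / w s).
  apply: Bc_unweighted.
  by apply: (@Bc_indic _ _ _ K) => //; exact: subIsetr.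
exists (cplx (fun s => \1_(B `&` K) s / w s)); split;
  [exact: Bc_wS|exact: density_Bc|].
rewrite cplxB (_ : (fun s => _) = (fun s => \1_(B `\` K) s / w s)).
  apply: (@le_lt_trans _ _ (e / 2)); last by rewrite [ltRHS]splitr ltrDl divr_gt0.
  apply: small; first exact: measurableD.
  apply: le_lt_trans UK; rewrite le_measure ?inE//; try exact: measurableD.
  exact: setSD.
apply/funext => s; rewrite -mulrBl; congr (_ / _); rewrite !indicE in_setI in_setD.
by case: (s \in B); case: (s \in K); rewrite /= ?subrr ?subr0.
Qed.

(** Density of the real functions of Cc, as an induction principle: a property that
    is stable under linear combinations and limits spreads from Cc to indicators of
    relatively compact sets, to Bc, to the functions 1_B / w with mu B finite, to
    the step functions divided by w, and to the whole algebra. *)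
Lemma wS_density f : wS f -> P f.
Proof.
move=> Sf; apply: Plim => // e e0.
have /wSP[Lf /(_ e e0) [g sg fg]] := Sf.
exists g; split => //; first exact: wSt_S.
have [[mg fr] Lg] := sg.
have [r rE] := level_sum fr.
pose F c : G -> R[i]^o := cplx (fun s => \1_(weighted w g @^-1` [set c]) s / w s).
have -> : g = \sum_(c <- r | c != 0) c *: F c.
  apply/funext => s; rewrite fct_sumE.
  have -> : g s = weighted w g s / (w s)%:C by rewrite /weighted mulfK ?w_neq0.
  rewrite rE mulr_suml; apply: eq_bigr => c _.
  by rewrite (_ : (c *: F c) s = c * F c s)// /F /cplx rmorphM /= fmorphV /= mulrA.
apply: (density_sum r (F := F) _).2 => c c0.
have mB := measurable_level c mg.
have Boo : (mu (weighted w g @^-1` [set c]) < +oo)%E by exact: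
  LPhi_level pair Phi_incr _ _ _ _ _.
split; [exact: unw_indic_wS|exact: density_unw_indic].
Qed.
End Induction.

(** * Translations and convolution *)

Local Notation conv := (convolution mu).
Local Notation rcv := (rconv mu).

(** In the supremum defining the norm the translation is moved from u to v, which
    preserves the unit ball for Psi; then w (t + s) <= C * w s * w t. *)
Lemma nrm_translate : exists2 C, 0 < C &
  forall (s : G) u, Bc u -> nrm (cplx (translate s u)) <= C * w s * nrm (cplx u).
Proof.
have [C C0 wC] := weight_mul weight_w; exists C => // s u nu.
have nsu := Bc_translate s nu.
have k0 : 0 <= C * w s by rewrite mulr_ge0 ?(ltW C0) ?(ltW (w_gt0 _)).
have [mu_ _ _] := nu; have [msu _ _] := nsu.
rewrite -lee_fin EFinM -!nrmE; [|exact: Bc_wL|exact: Bc_wL].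
rewrite /weighted_norm !weighted_cplx; apply: ge_ereal_sup => _ [v [mv vP] <-].
have mvs : cmeasurable (fun t => v (t + s)) by apply: (measurableT_comp mv);
  exact: measurable_shift.
have mcu : cmeasurable (cplx (fun t => u t * w t)).
  by apply: cmeasurable_cplx; apply: measurable_funM => //; exact: measurable_w.
have mcsu : cmeasurable (cplx (fun t => translate s u t * w t)).
  by apply: cmeasurable_cplx; apply: measurable_funM => //; exact: measurable_w.
apply: (@le_trans _ _ ((C * w s)%:E * \int[mu]_t
  (modulus (cplx (fun t => u t * w t) t * v (t + s)))%:E)%E).
  rewrite -(ge0_integral_shift haar_mu s (measurable_modulusM mcsu mv)); last first.
    by move=> t; rewrite lee_fin modulus_ge0.
  rewrite -ge0_integralZl_EFin//; last 2 first.
  - by move=> t _; rewrite lee_fin modulus_ge0.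
  - exact: measurable_modulusM.
  apply: ge0_le_integral => //.
  - by move=> t _; rewrite lee_fin modulus_ge0.
  - exact: (measurableT_comp (measurable_modulusM mcsu mv) (measurable_shift s)).
  - by apply: measurable_funeM; exact: measurable_modulusM.
  move=> t _; rewrite -EFinM lee_fin !modulusM !modulus_cplx mulrA ler_wpM2r
    ?modulus_ge0//.
  rewrite /translate addrK !normrM mulrCA ler_wpM2l// !ger0_norm ?(ltW (w_gt0 _))//.
  by rewrite addrC.
apply: lee_wpmul2l; first by rewrite lee_fin.
apply: ereal_sup_ubound; exists (fun t => v (t + s)) => //; split => //.
apply: le_trans vP; rewrite le_eqVlt; apply/orP; left; apply/eqP.
apply: (ge0_integral_shift haar_mu s (f := fun t => Psi (modulus (v t)))).
  by apply: measurable_young => //;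
    [by case: pair|exact: measurable_modulus|move=> t; exact: modulus_ge0].
by move=> t; case: pair => _ yPsi _; rewrite (young_ge0 yPsi)// modulus_ge0.
Qed.

Lemma conv_wL f g : wL f -> wL g -> wL (conv f g).
Proof. exact: (ba_mul alg). Qed.

Lemma conv_nrm : exists2 K, 0 < K & forall f g, wL f -> wL g ->
  nrm (conv f g) <= K * (nrm f * nrm g).
Proof.
have [K hK] := ba_norm_mul alg; exists (Num.max K 1);
  first by rewrite lt_max ltr01 orbT.
move=> f g Lf Lg; apply: (@le_trans _ _ (K * (nrm f * nrm g))).
  have h : (weighted_norm mu Psi w (conv f g) <=
    K%:E * (weighted_norm mu Psi w f * weighted_norm mu Psi w g))%E by exact: hK.
  by move: h; rewrite !nrmE ?lee_fin//; exact: conv_wL.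
by rewrite ler_wpM2r ?mulr_ge0 ?nrm_ge0// le_max lexx.
Qed.

Lemma rconv_support u v (K1 K2 : set G) : (forall s, ~ K1 s -> u s = 0) ->
  (forall s, ~ K2 s -> v s = 0) ->
  forall s, ~ [set a + b | a in K1 & b in K2] s -> rcv u v s = 0.
Proof.
move=> u0 v0 s nK; rewrite /rconv; transitivity (\int[mu]_t (cst 0 t)); last first.
  by rewrite /Rintegral integral0.
apply: eq_Rintegral => t _ /=; have [K1t|nK1t] := pselect (K1 t);
  last by rewrite u0// mul0r.
rewrite v0 ?mulr0// => K2s; apply: nK; exists t => //; exists (s - t) => //.
by rewrite addrC subrK.
Qed.

(** Induction over the centres a of a cover of the support of x by translates of V:
    on the part x1 of x carried by a + V, the value y (z - t) is replaced by
    y (z - a), at the cost of e times the integral of |x1|. The coefficients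
    depend on x and the cover only; one combination therefore serves several y. *)
Lemma rconv_translate_approx (s : seq G) (V : set G) : open V -> forall x, Bc x ->
  (forall t, x t <> 0 -> exists2 a, a \in s & V (t - a)) ->
  exists r : seq (R * G), (forall p, p \in r -> p.2 \in s) /\
    forall y e, Bc y -> (forall t t', V (t' - t) -> `|y t - y t'| <= e) ->
    forall z, `|rcv x y z - \sum_(p <- r) p.1 * y (z - p.2)| <=
      e * \int[mu]_t `|x t|.
Proof.
move=> oV; elim: s => [|a s IH] x nx xs.
  exists [::]; split => // y e _ _ z.
  have x0 t : x t = 0 by apply: contrapT => /xs[].
  have -> : rcv x y z = \int[mu]_t (cst 0 t) by apply: eq_Rintegral => t _;
    rewrite x0 mul0r.
  have -> : \int[mu]_t `|x t| = \int[mu]_t (cst 0 t) by apply: eq_Rintegral => t _;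
    rewrite x0 normr0.
  by rewrite big_nil /Rintegral integral0 subr0 normr0 mulr0.
pose W := [set t | V (t - a)].
have mV : measurable (V : set (borel G)) by exact: sub_sigma_algebra.
have mW : measurable (W : set (borel G)).
  by rewrite -[X in measurable X]setTI; exact: (measurable_shift (- a)).
(* x1 is concentrated at a up to V; x2 only sees the remaining centres. *)
pose x1 t := x t * \1_W t; pose x2 t := x t * \1_(~` W) t.
have nxI (B : set G) : measurable (B : set (borel G)) -> Bc (fun t => x t * \1_B t).
  move=> mB; have [m1 [M xM] [K cK xK]] := nx; split.
  - by apply: measurable_funM => //; exact: measurable_indic.
  - exists M => t; rewrite normrM indicE; case: (_ \in _);
    rewrite ?normr1 ?mulr1// normr0 mulr0.
    exact: le_trans (xM 0).
  - by exists K => // t nK; rewrite xK// mul0r.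
have n1 : Bc x1 by exact: nxI.
have n2 : Bc x2 by apply: nxI; exact: measurableC.
have x12 t : x t = x1 t + x2 t.
  rewrite /x1 /x2 !indicE in_setC; case: (_ \in _) => /=;
    by rewrite mulr0 mulr1 ?addr0 ?add0r.
have ax12 t : `|x t| = `|x1 t| + `|x2 t|.
  rewrite /x1 /x2 !indicE in_setC; case: (_ \in _) => /=;
    by rewrite mulr0 mulr1 normr0 ?addr0 ?add0r.
have [t x2t|r [rs rP]] := IH x2 n2.
  have nW : ~ W t by move=> Wt; apply: x2t; rewrite /x2 indicE memNset ?mulr0//=;
    exact.
  have [|b] := xs t; first by move=> xt; apply: x2t; rewrite /x2 xt mul0r.
  by rewrite inE => /predU1P[-> /nW//|bs Vb]; exists b.
have iN y : Bc y -> mu.-integrable setT (EFin \o y : borel G -> \bar R).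
  exact: Bc_integrable.
exists ((\int[mu]_t x1 t, a) :: r); split.
  by move=> p; rewrite !inE => /predU1P[->|/rs ->]; rewrite ?eqxx ?orbT.
move=> y e ny ye z; rewrite big_cons /=.
have nyz := Bc_reflect z ny.
have -> : rcv x y z = rcv x1 y z + rcv x2 y z.
  rewrite /rconv -RintegralD//; [|exact/iN/Bc_mul|exact/iN/Bc_mul].
  by apply: eq_Rintegral => t _; rewrite -mulrDl -x12.
rewrite opprD addrACA (_ : \int[mu]_t `|x t| =
  \int[mu]_t `|x1 t| + \int[mu]_t `|x2 t|); last first.
  rewrite -RintegralD//; [|exact/iN/Bc_norm|exact/iN/Bc_norm].
  by apply: eq_Rintegral => t _; rewrite ax12.
rewrite mulrDr; apply: (le_trans (ler_normD _ _)); apply: lerD; last exact: rP.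
have -> : rcv x1 y z - (\int[mu]_t x1 t) * y (z - a) =
  \int[mu]_t (x1 t * (y (z - t) - y (z - a))).
  rewrite -RintegralZr//; last exact: iN.
  rewrite -RintegralB//; [|exact/iN/Bc_mul|].
    by apply: eq_Rintegral => t _; rewrite mulrBr.
  have -> : (EFin \o (fun t => x1 t * y (z - a))) =
    (EFin \o (fun t => y (z - a) * x1 t)).
    by apply/funext => t /=; rewrite mulrC.
  by apply: iN; exact: BcZ.
have n3 : Bc (fun t => x1 t * (y (z - t) - y (z - a))).
  have -> : (fun t => x1 t * (y (z - t) - y (z - a))) =
      (fun t => x1 t * y (z - t) - y (z - a) * x1 t).
    by apply/funext => t; rewrite mulrBr [y (z - a) * _]mulrC.
  by apply: BcB; [exact: Bc_mul|exact: BcZ].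
apply: (le_trans (le_normr_Rintegral _ _)) => //; first exact: iN.
rewrite -RintegralZl//; last exact/iN/Bc_norm.
apply: le_Rintegral => //; first exact/iN/Bc_norm.
  by apply: (iN (fun t => e * `|x1 t|)); apply: BcZ; exact: Bc_norm.
move=> t _; rewrite normrM mulrC.
have [Wt|nWt] := pselect (W t); last first.
  by rewrite /x1 indicE memNset// mulr0 normr0 !mulr0.
rewrite ler_wpM2r//; apply: ye.
by rewrite opprB addrC addrA subrK.
Qed.

(** The convolution of u with a finitely supported measure, given by its masses
    and their positions. *)
Definition translate_comb (r : seq (R * G)) u : G -> R[i]^o :=
  \sum_(p <- r) p.1%:C *: cplx (translate p.2 u).

Lemma translate_comb_cplx r u :
  translate_comb r u = cplx (fun z => \sum_(p <- r) p.1 * u (z - p.2)).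
Proof.
apply/funext => z; rewrite /translate_comb fct_sumE /cplx rmorph_sum;
  apply: eq_bigr => p _ /=.
by rewrite rmorphM.
Qed.

Lemma wS_sum (T : Type) (r : seq T) (c : T -> R[i]) (F : T -> G -> R[i]^o) :
  (forall p, wS (F p)) ->
  wS (\sum_(p <- r) c p *: F p).
Proof.
move=> h; elim: r => [|p r IH]; first by rewrite big_nil; exact: wS0.
by rewrite big_cons; exact: wS_lin.
Qed.

Lemma wS_comb r u : Bc u -> wS (translate_comb r u).
Proof. by move=> nu; apply: wS_sum => p; apply: Bc_wS; exact: Bc_translate. Qed.

Lemma Cc_near u e : Cc u -> 0 < e ->
  \forall v \near (0 : G), forall t t', t' - t = v -> `|u t - u t'| <= e.
Proof.
move=> [cu [K cK uK]] e0; apply: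
  filterS (compact_uniform_continuous cu cK uK e0) => v h t t' tt'.
by rewrite distrC; have := ltW (h t); rewrite -tt' addrCA subrr addr0.
Qed.

(** The same combination has to work for y and z, since both of them occur in one
    application of D. *)
Lemma conv_translate_approx x y z e : Bc x -> Cc y -> Cc z -> 0 < e -> exists r,
  nrm (conv (cplx x) (cplx y) - translate_comb r y) < e /\
    nrm (conv (cplx x) (cplx z) - translate_comb r z) < e.
Proof.
move=> nx Cy Cz e0.
have [_ _ [Kx cKx xK]] := nx; have [_ [Ky cKy yK]] := Cy;
  have [_ [Kz cKz zK]] := Cz.
pose K := [set a + b | a in Kx & b in (Ky `|` Kz)].
have cK : compact K by apply: compact_addset => //; exact: compactU.
set I := \int[mu]_t `|x t|; have I0 : 0 <= I by exact: Rintegral_ge0.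
have n1 : Bc (\1_K : G -> R) by apply: (@Bc_indic _ _ _ K) => //;
  exact: compact_borel.
set N := nrm (cplx \1_K); have N0 : 0 <= N by apply: nrm_ge0; exact: Bc_wL.
have d0 : 0 < e / (I * N + 1) by rewrite divr_gt0// ltr_wpDl// mulr_ge0.
set d := e / _ in d0.
pose V := [set v | forall t t', t' - t = v -> `|y t - y t'| <= d /\
  `|z t - z t'| <= d]°.
have V0 : nbhs 0 V.
  apply: nbhs_interior; apply: filterS2 (Cc_near Cy d0) (Cc_near Cz d0) =>
    v h1 h2 t t' tt'.
  by split; [exact: h1|exact: h2].
have [s [sK Ks]] := compact_cover_shift cKx V0.
have [|r [rs rP]] := rconv_translate_approx (@open_interior _ _ : open V) nx
  (s := s).
  by move=> t xt; apply: Ks; apply: contrapT => /xK.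
have main u Ku : Cc u -> (forall t, ~ Ku t -> u t = 0) -> Ku `<=` Ky `|` Kz ->
    (forall t t', V (t' - t) -> `|u t - u t'| <= d) ->
      nrm (conv (cplx x) (cplx u) - translate_comb r u) < e.
  move=> Cu uK uyz ud; have nu := Cc_Bc Cu.
  have Lc : wL (conv (cplx x) (cplx u) - translate_comb r u).
    by apply: wLB; [apply: conv_wL; exact: Bc_wL|apply: wS_L; exact: wS_comb].
  apply: (@le_lt_trans _ _ (d * I * N)); last first.
    rewrite /d -mulrA mulrAC ltr_pdivrMr ?ltr_wpDl ?mulr_ge0//.
    by rewrite mulrDr mulr1 ltrDl.
  rewrite convolution_cplx translate_comb_cplx cplxB in Lc *.
  apply: nrm_le_compact => //; first by rewrite mulr_ge0// ltW.
    move=> t nK; rewrite (rconv_support xK uK) ?big1_seq ?subrr//.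
      move=> p /andP[_ pr]; have pK : Kx p.2 by apply: sK; exact: rs.
      rewrite uK ?mulr0// => Ku'; apply: nK; exists p.2 => //; exists (t - p.2);
        first exact: uyz.
      by rewrite addrC subrK.
    by move=> [a Ka [b Kb ab]]; apply: nK; exists a => //; exists b => //;
      exact: uyz.
  by move=> t; apply: rP.
exists r; split.
  apply: (main y Ky) => // t t' /interior_subset h.
  by have [] := h t t' erefl.
apply: (main z Kz) => // t t' /interior_subset h.
by have [] := h t t' erefl.
Qed.

Lemma wS_null f g : wS g -> wL f -> ae_zero mu (f - g) -> wS f.
Proof.
move=> Sg Lf fg; apply: wS_closed => // e e0; exists g => //.
by rewrite (nrm_ae _).2//; apply: wLB => //; exact: wS_L.
Qed.

Lemma conv_linl a f g h : wL f -> wL g -> wL h ->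
  ae_zero mu (conv (a *: f + g) h - (a *: conv f h + conv g h)).
Proof. exact: (ba_mul_linl alg). Qed.

Lemma conv_linr a f g h : wL f -> wL g -> wL h ->
  ae_zero mu (conv h (a *: f + g) - (a *: conv h f + conv h g)).
Proof. exact: (ba_mul_linr alg). Qed.

Lemma convA f g h : wL f -> wL g -> wL h ->
  ae_zero mu (conv (conv f g) h - conv f (conv g h)).
Proof. exact: (ba_mulA alg). Qed.

Lemma nrm_eq f g : wL f -> wL g -> ae_zero mu (f - g) -> nrm (f - g) = 0.
Proof. by move=> Lf Lg; apply: (nrm_ae _).2; exact: wLB. Qed.

Lemma nrm_null f g : wL f -> wL g -> ae_zero mu (f - g) -> nrm f = nrm g.
Proof.
move=> Lf Lg fg; have fg0 := nrm_eq Lf Lg fg; apply/eqP; rewrite eq_le; apply/andP;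
  split.
  have := nrmD (wLB Lf Lg) Lg; by rewrite subrK fg0 add0r.
have := nrmD (wLB Lg Lf) Lf; by rewrite subrK nrmBC// fg0 add0r.
Qed.

Lemma conv_subl f g h : wL f -> wL g -> wL h ->
  nrm (conv f h - conv g h) = nrm (conv (f - g) h).
Proof.
move=> Lf Lg Lh; apply/esym; apply: nrm_null.
- by apply: conv_wL => //; exact: wLB.
- by apply: wLB; exact: conv_wL.
have := conv_linl (-1) Lg Lf Lh; rewrite !scaleN1r.
by rewrite [- g + f]addrC [- conv g h + _]addrC.
Qed.

Lemma conv_subr f g h : wL f -> wL g -> wL h ->
  nrm (conv h f - conv h g) = nrm (conv h (f - g)).
Proof.
move=> Lf Lg Lh; apply/esym; apply: nrm_null.
- by apply: conv_wL => //; exact: wLB.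
- by apply: wLB; exact: conv_wL.
have := conv_linr (-1) Lg Lf Lh; rewrite !scaleN1r.
by rewrite [- g + f]addrC [- conv h g + _]addrC.
Qed.

(** For x and y in Cc the product is a limit of combinations of translates of y.
    The general case follows by density in each factor, the multiplication of the
    larger algebra being bounded. *)
Lemma wS_conv f g : wS f -> wS g -> wS (conv f g).
Proof.
have [C C0 hC] := conv_nrm.
have step1 x y : Bc x -> Cc y -> wS (conv (cplx x) (cplx y)).
  move=> nx Cy; apply: wS_closed.
    by apply: conv_wL; apply: Bc_wL => //; exact: Cc_Bc.
  move=> e e0; have [r [h _]] := conv_translate_approx nx Cy Cy e0.
  by exists (translate_comb r y) => //; apply: wS_comb; exact: Cc_Bc.
have step2 f' y : wS f' -> Cc y -> wS (conv f' (cplx y)).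
  move=> Sf Cy; have Ly : wL (cplx y) by apply: Bc_wL; exact: Cc_Bc.
  have N0 : 0 <= nrm (cplx y) := nrm_ge0 Ly.
  apply: (@wS_density (fun f => wS (conv f (cplx y)))) Sf.
  - by move=> u Cu; apply: step1 => //; exact: Cc_Bc.
  - move=> a f1 f2 S1 S2 h1 h2; apply: (wS_null (wS_lin a h1 h2)).
      by apply: conv_wL => //; apply: wL_lin; exact: wS_L.
    by apply: conv_linl => //; exact: wS_L.
  move=> f1 S1 h; have L1 := wS_L S1; apply: wS_closed; first exact: conv_wL.
  move=> e e0; have d0 : 0 < e / (C * nrm (cplx y) + 1) by rewrite divr_gt0//
    ltr_wpDl// mulr_ge0// ltW.
  have [f2 [S2 h2 f12]] := h _ d0; have L2 := wS_L S2.
  exists (conv f2 (cplx y)) => //; rewrite conv_subl//.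
  apply: (le_lt_trans (hC _ _ (wLB L1 L2) Ly)).
  rewrite mulrCA; apply: (@le_lt_trans _ _
    (e / (C * nrm (cplx y) + 1) * (C * nrm (cplx y)))).
    by apply: ler_wpM2r; [rewrite mulr_ge0// ltW|exact: ltW].
  by rewrite mulrAC ltr_pdivrMr ?ltr_wpDl ?mulr_ge0 ?(ltW C0)// mulrDr mulr1 ltrDl.
move=> Sf Sg; have Lf := wS_L Sf; have N0 : 0 <= nrm f := nrm_ge0 Lf.
apply: (@wS_density (fun g => wS (conv f g))) Sg.
- by move=> u Cu; exact: step2.
- move=> a f1 f2 S1 S2 h1 h2; apply: (wS_null (wS_lin a h1 h2)).
    by apply: conv_wL => //; apply: wL_lin; exact: wS_L.
  by apply: conv_linr => //; exact: wS_L.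
move=> f1 S1 h; have L1 := wS_L S1; apply: wS_closed; first exact: conv_wL.
move=> e e0; have d0 : 0 < e / (C * nrm f + 1) by rewrite divr_gt0// ltr_wpDl//
  mulr_ge0// ltW.
have [f2 [S2 h2 f12]] := h _ d0; have L2 := wS_L S2.
exists (conv f f2) => //; rewrite conv_subr//.
apply: (le_lt_trans (hC _ _ Lf (wLB L1 L2))).
rewrite mulrA mulrC; apply: (@le_lt_trans _ _ (e / (C * nrm f + 1) * (C * nrm f))).
  by apply: ler_wpM2r; [rewrite mulr_ge0// ltW|exact: ltW].
by rewrite mulrAC ltr_pdivrMr ?ltr_wpDl ?mulr_ge0 ?(ltW C0)// mulrDr mulr1 ltrDl.
Qed.

(** b is the normalized indicator of a small symmetric neighbourhood of 0. By
    symmetry b (s - t) = b (t - s) has integral 1 in t, so that the error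
    (u * b) s - u s is the integral of (u t - u s) * b (s - t). *)
Lemma approx_unit u v e : Cc u -> Cc v -> 0 < e -> exists b, [/\ Bc b,
  nrm (conv (cplx u) (cplx b) - cplx u) < e & nrm (conv (cplx v) (cplx b) - cplx v)
    < e].
Proof.
move=> Cu Cv e0.
have [_ [Ku cKu uK]] := Cu; have [_ [Kv cKv vK]] := Cv.
have [V0 V00 cV0] := compact_nbhs0 lcG.
pose K := [set a + b | a in (Ku `|` Kv) & b in V0].
have cK : compact K by apply: compact_addset => //; exact: compactU.
have n1 : Bc (\1_K : G -> R) by apply: (@Bc_indic _ _ _ K) => //;
  exact: compact_borel.
set N := nrm (cplx \1_K); have N0 : 0 <= N by apply: nrm_ge0; exact: Bc_wL.
have d0 : 0 < e / (N + 1) by rewrite divr_gt0// ltr_wpDl.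
set d := e / _ in d0.
pose W := [set t | V0 t /\ forall s s', s' - s = t -> `|u s - u s'| <= d /\
  `|v s - v s'| <= d]°.
have W0 : nbhs 0 W.
  apply: nbhs_interior; apply: filterS3 V00 (Cc_near Cu d0) (Cc_near Cv d0) =>
    t Vt h1 h2.
  by split => // s s' ss'; split; [exact: h1|exact: h2].
pose V := W `&` (-%R @^-1` W).
have VN t : V t -> V (- t) by move=> [Wt WNt]; split => //; rewrite /= opprK.
have V0t t : V t -> V0 t by move=> [/interior_subset[]].
have oV : open V.
  apply: openI; first exact: open_interior.
  by apply: open_comp; [move=> x _; exact: opp_continuous|exact: open_interior].
have mV : measurable (V : set (borel G)) by exact: sub_sigma_algebra.
have V00' : V 0 by split; rewrite /= ?oppr0; exact: nbhs_singleton.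
have muV : (0 < mu V)%E by apply: (haar_open_gt0 hG haar_mu oV); exists 0.
have Voo : (mu V < +oo)%E.
  apply: le_lt_trans (haar_compact haar_mu cV0); apply: le_measure; rewrite ?inE//.
  exact: compact_borel.
have m0 : 0 < fine (mu V) by rewrite fine_gt0// muV.
set m := fine _ in m0.
have nV : Bc (\1_V : G -> R) by apply: (@Bc_indic _ _ _ V0).
pose b t := m^-1 * \1_V t.
have nb : Bc b by exact: BcZ.
have b0 t : 0 <= b t by rewrite mulr_ge0// invr_ge0 ltW.
have iN y : Bc y -> mu.-integrable setT (EFin \o y : borel G -> \bar R).
  exact: Bc_integrable.
have bint s : \int[mu]_t b (s - t) = 1.
  have -> : \int[mu]_t b (s - t) = \int[mu]_t b (t - s).
    apply: eq_Rintegral => t _; rewrite /b !indicE; congr (_ * (nat_of_bool _)%:R).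
    by apply/idP/idP; rewrite !inE => /VN; rewrite opprB.
  rewrite (integral_shift haar_mu (- s)); last by case: nb.
  rewrite RintegralZl//; last exact: iN.
  by rewrite /Rintegral integral_indic// setIT mulVf// gt_eqF.
have main x Kx : Cc x -> (forall t, ~ Kx t -> x t = 0) -> Kx `<=` Ku `|` Kv ->
    (forall t t', V (t' - t) -> `|x t - x t'| <= d) ->
      nrm (conv (cplx x) (cplx b) - cplx x) < e.
  move=> Cx xK xuv xd; have nx := Cc_Bc Cx.
  have Lc : wL (conv (cplx x) (cplx b) - cplx x).
    by apply: wLB; [apply: conv_wL|]; exact: Bc_wL.
  apply: (@le_lt_trans _ _ (d * N)); last first.
    by rewrite /d mulrAC ltr_pdivrMr ?ltr_wpDl// mulrDr mulr1 ltrDl.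
  rewrite convolution_cplx cplxB in Lc *.
  apply: nrm_le_compact => //; first exact: ltW.
    move=> t nK; rewrite (@rconv_support x b Kx V0 xK).
    - rewrite xK ?subrr// => Kt; apply: nK; exists t; first exact: xuv.
      by exists 0; rewrite ?addr0//; exact: nbhs_singleton.
    - by move=> s nV0; rewrite /b indicE memNset ?mulr0// => /V0t.
    - by move=> [p Kp [q Kq pq]]; apply: nK; exists p; [exact: xuv|exists q].
  move=> s; have nbs := Bc_reflect s nb.
  have -> : rcv x b s - x s = \int[mu]_t ((x t - x s) * b (s - t)).
    rewrite -[x s]mulr1 -[in X in _ - X](bint s) -RintegralZl//; last exact: iN.
    rewrite -RintegralB//; [|exact/iN/Bc_mul|by apply:
      (iN (fun t => x s * b (s - t))); exact: BcZ].
    by apply: eq_Rintegral => t _; rewrite mulr1 mulrBl.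
  have n3 : Bc (fun t => (x t - x s) * b (s - t)).
    have -> : (fun t => (x t - x s) * b (s - t)) =
      (fun t => x t * b (s - t) - x s * b (s - t)).
      by apply/funext => t; rewrite mulrBl.
    by apply: BcB; [exact: Bc_mul|exact: BcZ].
  apply: (le_trans (le_normr_Rintegral _ _)) => //; first exact: iN.
  rewrite -[leRHS]mulr1 -(bint s) -RintegralZl//; last exact: iN.
  apply: le_Rintegral => //.
  - exact: (iN _ (Bc_norm n3)).
  - by apply: (iN (fun t => d * b (s - t))); exact: BcZ.
  move=> t _; rewrite normrM (ger0_norm (b0 _)).
  have [Vt|nVt] := pselect (V (s - t)); last by rewrite /b indicE memNset// !mulr0.
  by rewrite ler_wpM2r// xd.
exists b; split => //.
  apply: (main u Ku) => // t t' [/interior_subset[_ h] _].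
  by have [] := h t t' erefl.
apply: (main v Kv) => // t t' [/interior_subset[_ h] _].
by have [] := h t t' erefl.
Qed.

(** * Functionals and additive functions *)

Lemma translate0 u : translate 0 u = u.
Proof. by apply/funext => t; rewrite /translate subr0. Qed.

Lemma translateD (s t : G) u : translate s (translate t u) = translate (s + t) u.
Proof. by apply/funext => x; rewrite /translate opprD addrA. Qed.

Lemma conv_translate (s t : G) u v : Bc u -> Bc v ->
  conv (cplx (translate s u)) (cplx (translate t v)) =
    cplx (translate (s + t) (rcv u v)).
Proof.
move=> nu nv; rewrite convolution_cplx rconv_translatel//; last exact: Bc_translate.
by rewrite rconv_translater translateD.
Qed.

(** The continuous linear functionals on the algebra. Compatibility with equality
    almost everywhere follows from the bound (bounded_functional_null). *)
Definition bounded_functional (phi : (G -> R[i]^o) -> R[i]^o) : Prop :=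
  (forall a f g, wS f -> wS g -> phi (a *: f + g) = a * phi f + phi g) /\
  exists2 K, 0 <= K & forall f, wS f -> modulus (phi f) <= K * nrm f.

Lemma modulus_le_small (c : R[i]^o) M : 0 <= M ->
  (forall e, 0 < e -> modulus c <= e * M) -> c = 0.
Proof.
move=> M0 h; apply: modulus_eq0; apply/eqP; rewrite eq_le modulus_ge0 andbT.
apply/ler_addgt0Pl => e e0; rewrite addr0.
have d0 : 0 < e / (M + 1) by rewrite divr_gt0// ltr_wpDl.
apply: (le_trans (h _ d0)); rewrite mulrAC ler_pdivrMr ?ltr_wpDl//.
by rewrite mulrDr mulr1 lerDl ltW.
Qed.

Lemma bounded_functionalB phi f g : bounded_functional phi -> wS f -> wS g ->
  phi (f - g) = phi f - phi g.
Proof.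
move=> [lin _] Sf Sg; have := lin (-1) g f Sg Sf.
by rewrite scaleN1r addrC => ->; rewrite mulN1r addrC.
Qed.

Lemma bounded_functional_null phi f g : bounded_functional phi -> wS f -> wS g ->
  ae_zero mu (f - g) -> phi f = phi g.
Proof.
move=> bphi Sf Sg fg; apply/eqP; rewrite -subr_eq0 -bounded_functionalB//;
  apply/eqP.
have SB := wSB Sf Sg.
have [_ [K K0 hK]] := bphi; apply: (@modulus_le_small _ 0) => // e e0;
  rewrite mulr0.
by apply: le_trans (hK _ SB) _; rewrite nrm_eq ?mulr0//; exact: wS_L.
Qed.

Lemma bounded_functional_diff phi psi : bounded_functional phi ->
  bounded_functional psi -> bounded_functional (fun f => phi f - psi f).
Proof.
move=> [l1 [K1 K10 h1]] [l2 [K2 K20 h2]]; split.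
  by move=> a f g Sf Sg; rewrite l1// l2// mulrBr opprD addrACA.
exists (K1 + K2); first exact: addr_ge0.
move=> f Sf; apply: (le_trans (modulusD _ _)); rewrite modulusN mulrDl.
by apply: lerD; [exact: h1|exact: h2].
Qed.

Lemma bounded_functional_convl phi h : bounded_functional phi -> wS h ->
  bounded_functional (fun f => phi (conv f h)).
Proof.
move=> bphi Sh; have [l1 [K1 K10 h1]] := bphi; have Lh := wS_L Sh; split.
  move=> a f g Sf Sg; have Lf := wS_L Sf; have Lg := wS_L Sg.
  rewrite -l1; [|exact: wS_conv|exact: wS_conv].
  apply: (bounded_functional_null bphi);
    [|by apply: wS_lin; exact: wS_conv|exact: conv_linl].
  by apply: wS_conv; [exact: wS_lin|exact: Sh].
have [C C0 hC] := conv_nrm; exists (K1 * (C * nrm h)).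
  by rewrite !mulr_ge0 ?(ltW C0) ?nrm_ge0.
move=> f Sf; apply: le_trans (h1 _ (wS_conv Sf Sh)) _; rewrite -mulrA ler_wpM2l//.
have := hC _ _ (wS_L Sf) Lh; rewrite (mulrC (nrm f)) mulrA; exact.
Qed.

Lemma bounded_functional_convr phi h : bounded_functional phi -> wS h ->
  bounded_functional (fun f => phi (conv h f)).
Proof.
move=> bphi Sh; have [l1 [K1 K10 h1]] := bphi; have Lh := wS_L Sh; split.
  move=> a f g Sf Sg; have Lf := wS_L Sf; have Lg := wS_L Sg.
  rewrite -l1; [|exact: wS_conv|exact: wS_conv].
  apply: (bounded_functional_null bphi);
    [|by apply: wS_lin; exact: wS_conv|exact: conv_linr].
  by apply: wS_conv; [exact: Sh|exact: wS_lin].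
have [C C0 hC] := conv_nrm; exists (K1 * (C * nrm h)).
  by rewrite !mulr_ge0 ?(ltW C0) ?nrm_ge0.
move=> f Sf; apply: le_trans (h1 _ (wS_conv Sh Sf)) _; rewrite -mulrA ler_wpM2l//.
have := hC _ _ Lh (wS_L Sf); rewrite mulrA; exact.
Qed.

Lemma bounded_functional_density phi : bounded_functional phi ->
  (forall u, Cc u -> phi (cplx u) = 0) -> forall f, wS f -> phi f = 0.
Proof.
move=> bphi h f; have [l1 [K K0 hK]] := bphi.
apply: (@wS_density (fun f => phi f = 0)) => //.
  by move=> a f1 f2 S1 S2 h1 h2; rewrite l1// h1 h2 mulr0 addr0.
move=> f1 S1 hf; apply: (@modulus_le_small _ K) => // e e0.
have [f2 [S2 h2 f12]] := hf e e0.
have SB := wSB S1 S2.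
rewrite -[phi f1]subr0 -h2 -bounded_functionalB//; apply: (le_trans (hK _ SB)).
by rewrite mulrC ler_wpM2r// ltW.
Qed.

Lemma bounded_functional_close phi f : bounded_functional phi -> wS f ->
  (forall e : R, 0 < e -> exists2 g, wS g /\ phi g = 0 & nrm (f - g) < e) ->
  phi f = 0.
Proof.
move=> bphi Sf hf; have [_ [K K0 hK]] := bphi.
apply: (@modulus_le_small _ K) => // d d0; have [g [Sg g0] fg] := hf d d0.
rewrite -[phi f]subr0 -g0 -bounded_functionalB//;
  apply: (le_trans (hK _ (wSB Sf Sg))).
by rewrite mulrC ler_wpM2r// ltW.
Qed.

Hypothesis no_hom : ~ exists xi : G -> R[i]^o,
      [/\ {morph xi : s t / s + t}, continuous xi,
          (exists s, xi s <> 0) & Linfty mu (tilde w xi)].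

(** xi v = xi (n v) / n, where n v still lies in the set on which xi is bounded if
    v is close to 0. *)
Lemma additive_bounded_continuous (xi : G -> R) M : {morph xi : s t / s + t} ->
  (\forall v \near (0 : G), `|xi v| <= M) -> continuous xi.
Proof.
move=> ximorph hM.
have xi0 : xi 0 = 0 by apply: (addrI (xi 0)); rewrite -ximorph !addr0.
have xin n (v : G) : xi (v *+ n) = xi v *+ n.
  by elim: n => [|n IH]; rewrite ?mulr0n// !mulrS ximorph IH.
have mulrn_cont n : continuous (fun v : G => v *+ n).
  elim: n => [|n IH] v.
    have -> : (fun v : G => v *+ 0) = cst 0 by apply/funext => x; rewrite mulr0n.
    exact: cvg_cst.
  have -> : (fun v : G => v *+ n.+1) = (fun v : G => v + v *+ n) by apply/funext =>
    x; rewrite mulrS.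
  apply: (@continuous_comp _ _ _ (fun v : G => (v, v *+ n))
    (fun p : G * G => p.1 + p.2)); last exact: add_continuous.
  by apply: cvg_pair; [exact: cvg_id|exact: IH].
have c0 e : 0 < e -> \forall v \near (0 : G), `|xi v| < e.
  move=> e0; pose n := (Num.bound (`|M| / e)).
  have hn : \forall v \near (0 : G), `|xi (v *+ n.+1)| <= M.
    by have := mulrn_cont n.+1 0; rewrite /continuous_at mul0rn => /(_ _ hM) h';
      exact: h'.
  apply: filterS hn => v; rewrite xin -mulr_natl normrM ger0_norm// => h.
  rewrite -(ltr_pM2l (ltr0Sn R n)); apply: (le_lt_trans h);
    apply: (le_lt_trans (ler_norm _)).
  rewrite -ltr_pdivrMr//; apply: (@lt_trans _ _ n%:R); last by rewrite ltr_nat.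
  by apply: archi_boundP; rewrite divr_ge0// ltW.
move=> s; apply/cvgrPdist_lt => e e0.
apply/nbhs_shift; apply: filterS (c0 e e0) => v.
by rewrite ximorph opprD addrA subrr sub0r normrN.
Qed.

(** Since w is bounded near 0, so is xi, which is therefore continuous; the bound
    says that tilde w xi is bounded. *)
Lemma hom_trivial (xi : G -> R) M : 0 <= M -> {morph xi : s t / s + t} ->
  (forall s, `|xi s| <= M * (w s * w (- s))) -> forall s, xi s = 0.
Proof.
move=> M0 ximorph xiM s; apply: contrapT => xis; apply: no_hom.
have [N wN] := weight_near0 hG lcG haar_mu weight_w.
have wN' : \forall v \near (0 : G), w (- v) <= N.
  by have := @opp_continuous G 0; rewrite /continuous_at oppr0 => /(_ _ wN) h';
    exact: h'.
have cxi : continuous xi.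
  apply: (@additive_bounded_continuous _ (M * (N * N))) => //.
  apply: filterS2 wN wN' => v v1 v2; apply: (le_trans (xiM v)); rewrite ler_wpM2l//.
  by apply: ler_pM => //; rewrite ltW ?w_gt0.
exists (cplx xi); split.
- by move=> t t'; rewrite /cplx ximorph rmorphD.
- by move=> t; apply: (@continuous_comp _ _ _ xi (fun r : R => (r%:C : R[i]^o)));
  [exact: cxi|exact: continuous_real_complex].
- by exists s => -[].
have tE : tilde w (cplx xi) = cplx (fun s => xi s / (w s * w (- s))).
  by apply/funext => t; rewrite /tilde /cplx [RHS]rmorphM /= fmorphV.
have mwN : measurable_fun setT ((fun s => (w (- s))^-1) : borel G -> R).
  by apply: (measurableT_comp measurable_winv); apply: continuous_borel;
    exact: opp_continuous.
split.
  rewrite tE; apply: cmeasurable_cplx.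
  rewrite (_ : (fun s => _) = (fun s => xi s * ((w s)^-1 * (w (- s))^-1)));
    last first.
    by apply/funext => t; rewrite invfM.
  apply: measurable_funM; first exact: continuous_borelR.
  by apply: measurable_funM => //; exact: measurable_winv.
apply: (@le_lt_trans _ _ M%:E); last by rewrite ltry.
apply/ess_supP; apply: aeW => t; rewrite tE modulus_cplx lee_fin.
have ww : 0 < w t * w (- t) by rewrite mulr_gt0 ?w_gt0.
by rewrite normrM normfV (gtr0_norm ww) ler_pdivrMr.
Qed.

(** * Derivations *)

Variable D : (G -> R[i]^o) -> (G -> R[i]^o) -> R[i]^o.
Hypothesis derD : @bounded_derivation R (SPhiw mu Phi Psi w) D.

Lemma subr_approx (V : zmodType) (p1 p2 q1 q2 a1 a2 : V) :
  a1 = p1 - q1 -> a2 = p2 - q2 -> q1 = q2 -> p1 - p2 = a1 - a2.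
Proof. by move=> -> -> ->; rewrite opprB addrA subrK. Qed.

Lemma le_mul_small (c n e K : R) : 0 <= K -> c <= K * n -> n <= e -> c <= e * K.
Proof. by move=> K0 cn ne; apply: (le_trans cn); rewrite mulrC ler_wpM2r. Qed.

Lemma D_bound : exists2 K, 0 <= K & forall f g, wS f -> wS g ->
  modulus (D f g) <= K * (nrm f * nrm g).
Proof.
have [K hK] := der_bounded derD; exists (Num.max K 0);
  first by rewrite le_max lexx orbT.
move=> f g Sf Sg; have Lf := wS_L Sf; have Lg := wS_L Sg.
have h : ((modulus (D f g))%:E <=
    K%:E * (weighted_norm mu Psi w f * weighted_norm mu Psi w g))%E by exact:
      (hK f g Sf Sg).
rewrite !nrmE// lee_fin in h; apply: (le_trans h).
by rewrite ler_wpM2r ?mulr_ge0 ?nrm_ge0// le_max lexx.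
Qed.

Lemma bounded_functional_Dr f : wS f -> bounded_functional (D f).
Proof.
move=> Sf; split; first by move=> a g h Sg Sh;
  exact: (dual_lin (der_dual derD Sf) a Sg Sh).
have [K K0 hK] := D_bound; exists (K * nrm f);
  first by rewrite mulr_ge0// nrm_ge0//; exact: wS_L.
by move=> g Sg; rewrite -mulrA; exact: hK.
Qed.

Lemma bounded_functional_Dl g : wS g -> bounded_functional (D ^~ g).
Proof.
move=> Sg; split; first by move=> a f h Sf Sh; exact: (der_lin derD a Sf Sh Sg).
have [K K0 hK] := D_bound; exists (K * nrm g);
  first by rewrite mulr_ge0// nrm_ge0//; exact: wS_L.
by move=> f Sf; rewrite -mulrA [nrm g * _]mulrC; exact: hK.
Qed.

Lemma D_mul f g h : wS f -> wS g -> wS h ->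
  D (conv f g) h = D g (conv h f) + D f (conv g h).
Proof. exact: (der_mul derD). Qed.

(** Formally A s - A 0 is the value of delta_(-s) . D(delta_s) at f * k * g. Put
    H s = D(tau_s (f * k))(tau_(-s) g) and B t = D(tau_t k)(tau_(-t) (g * f)).
    As (tau_s f) * (tau_t k) = tau_(s+t) (f * k), the derivation rule reads
    H (s + t) = B t + A s, and such an equation forces additivity. *)
Lemma D_translate_pair_additive (f k g : G -> R) : Bc f -> Bc k -> Bc g ->
  let A s := D (cplx (translate s f)) (cplx (translate (- s) (rcv k g))) in
  forall s t, A (s + t) - A 0 = (A s - A 0) + (A t - A 0).
Proof.
move=> nf nk ng A s t.
pose H s := D (cplx (translate s (rcv f k))) (cplx (translate (- s) g)).
pose B t := D (cplx (translate t k)) (cplx (translate (- t) (rcv g f))).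
have HAB s' t' : H (s' + t') = B t' + A s'.
  rewrite /H -conv_translate// D_mul; [|exact/Bc_wS/Bc_translate..].
  rewrite !conv_translate//.
  have -> : - (s' + t') + s' = - t' by rewrite opprD addrAC addNr add0r.
  by have -> : t' + - (s' + t') = - s' by rewrite opprD addrCA subrr addr0.
have HA s' : H s' = B 0 + A s' by rewrite -HAB addr0.
have HB t' : H t' = B t' + A 0 by rewrite -HAB add0r.
have E : A (s + t) = A t - A 0 + A s.
  apply: (addrI (B 0)); rewrite -HA HAB;
    have -> : B t = H t - A 0 by rewrite HB addrK.
  by rewrite HA !addrA.
by rewrite E [RHS]addrC addrA.
Qed.

(** A s - A 0 is additive in s and bounded by a multiple of w s * w (- s), so
    hom_trivial kills its real and imaginary parts. *)
Lemma D_translate_rconv (f k g : G -> R) s : Bc f -> Bc k -> Bc g ->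
  D (cplx (translate s f)) (cplx (translate (- s) (rcv k g))) =
    D (cplx f) (cplx (rcv k g)).
Proof.
move=> nf nk ng.
pose A s := D (cplx (translate s f)) (cplx (translate (- s) (rcv k g))).
suff : A s - A 0 = 0.
  by move/eqP; rewrite subr_eq0 => /eqP; rewrite /A oppr0 !translate0.
have Aadd s' t : A (s' + t) - A 0 = (A s' - A 0) + (A t - A 0) by exact:
  D_translate_pair_additive.
have [K K0 hK] := D_bound; have [C C0 hC] := conv_nrm;
  have [T T0 hT] := nrm_translate.
have [Cw Cw0 wC] := weight_mul weight_w.
have Lf := Bc_wL nf; have Lk := Bc_wL nk; have Lg := Bc_wL ng.
pose M := K * (T * nrm (cplx f) * (C * (nrm (cplx k) * (T * nrm (cplx g))))).
have M0 : 0 <= M by rewrite !mulr_ge0 ?nrm_ge0// ltW.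
have ww0 t : 0 <= w t * w (- t) by rewrite mulr_ge0// ltW// w_gt0.
have AM t : modulus (A t) <= M * (w t * w (- t)).
  have nt := Bc_translate t nf; have ngt := Bc_translate (- t) ng.
  have E : cplx (translate (- t) (rcv k g)) =
    conv (cplx k) (cplx (translate (- t) g)).
    by rewrite -[in RHS](translate0 k) conv_translate// add0r.
  rewrite /A E; apply: le_trans (hK _ _ _ _) _;
    [exact: Bc_wS|by apply: wS_conv; exact: Bc_wS|].
  have -> : M * (w t * w (- t)) =
      K * ((T * w t * nrm (cplx f)) *
        (C * (nrm (cplx k) * (T * w (- t) * nrm (cplx g))))).
    rewrite /M; move: (nrm _) (nrm _) (nrm _) (w t) (w (- t)) => n1 n2 n3 w1 w2;
      ring.
  rewrite ler_wpM2l//; apply: ler_pM.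
  - exact/nrm_ge0/Bc_wL.
  - by apply: nrm_ge0; apply: conv_wL; exact: Bc_wL.
  - exact: hT.
  apply: le_trans (hC _ _ Lk (Bc_wL ngt)) _; rewrite ler_wpM2l ?(ltW C0)//.
  by rewrite ler_wpM2l ?nrm_ge0//; exact: hT.
have w1 t : 1 <= Cw * (w t * w (- t)).
  by rewrite mulrA -(weight_0 weight_w) -(subrr t); exact: wC.
(* As 1 <= Cw * (w t * w (- t)), the constant A 0 is absorbed as well. *)
pose M' := M + M * Cw; have M'0 : 0 <= M' by rewrite addr_ge0// mulr_ge0// ltW.
have AB t : modulus (A t - A 0) <= M' * (w t * w (- t)).
  apply: (le_trans (modulusD _ _)); rewrite modulusN mulrDl; apply: lerD => //.
  apply: (le_trans (AM 0)); rewrite oppr0 (weight_0 weight_w) mulr1 mulr1.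
  by rewrite -mulrA -[leLHS]mulr1 ler_wpM2l.
have re0 : complex.Re (A s - A 0) = 0.
  apply: (@hom_trivial (fun t => complex.Re (A t - A 0)) M') => //.
    by move=> t t'; rewrite Aadd ReD.
  by move=> t; apply: le_trans (Re_modulus _) (AB t).
have im0 : complex.Im (A s - A 0) = 0.
  apply: (@hom_trivial (fun t => complex.Im (A t - A 0)) M') => //.
    by move=> t t'; rewrite Aadd ImD.
  by move=> t; apply: le_trans (Im_modulus _) (AB t).
by move: re0 im0; case: (A s - A 0) => a b /= -> ->.
Qed.

(** D_translate_rconv with an approximate unit in the place of g. *)
Lemma D_translate (f z : G -> R) s : Bc f -> Cc z ->
  D (cplx (translate s f)) (cplx z) = D (cplx f) (cplx (translate s z)).
Proof.
move=> nf Cz; have Cz' := Cc_translate s Cz; set z' := translate s z in Cz' *.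
have ntf := Bc_translate s nf.
have [Sf Stf] := (Bc_wS nf, Bc_wS ntf).
have [Sz Sz'] := (Bc_wS (Cc_Bc Cz), Bc_wS (Cc_Bc Cz')).
have [b1 [K1 K10 h1]] := bounded_functional_Dr Stf;
  have [b2 [K2 K20 h2]] := bounded_functional_Dr Sf.
apply/eqP; rewrite -subr_eq0; apply/eqP.
apply: (@modulus_le_small _ (K1 + K2)); first exact: addr_ge0.
move=> e e0; have [b [nb zb zb']] := approx_unit Cz Cz' e0.
have Sb := Bc_wS nb.
have E : D (cplx (translate s f)) (conv (cplx z) (cplx b)) =
  D (cplx f) (conv (cplx z') (cplx b)).
  have <- : cplx (translate (- s) (rcv z' b)) = conv (cplx z) (cplx b).
    have nz' := Cc_Bc Cz'.
    have zE : z = translate (- s) z' by rewrite translateD addNr translate0.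
    by rewrite [in RHS]zE -[in RHS](translate0 b) conv_translate// addr0.
  by rewrite D_translate_rconv ?convolution_cplx//; exact: Cc_Bc.
have Szb : wS (conv (cplx z) (cplx b)) by exact: wS_conv.
have Szb' : wS (conv (cplx z') (cplx b)) by exact: wS_conv.
have -> : D (cplx (translate s f)) (cplx z) - D (cplx f) (cplx z') =
    D (cplx (translate s f)) (cplx z - conv (cplx z) (cplx b)) - D (cplx f)
      (cplx z' - conv (cplx z') (cplx b)).
  exact: (subr_approx (bounded_functionalB (bounded_functional_Dr Stf) Sz Szb)
    (bounded_functionalB (bounded_functional_Dr Sf) Sz' Szb') E).
apply: (le_trans (modulusD _ _)); rewrite modulusN mulrDr; apply: lerD.
  apply: (le_mul_small K10 (h1 _ (wSB Sz Szb))).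
  by rewrite (nrmBC (wS_L Sz) (wS_L Szb)) ltW.
apply: (le_mul_small K20 (h2 _ (wSB Sz' Szb'))).
by rewrite (nrmBC (wS_L Sz') (wS_L Szb')) ltW.
Qed.

Lemma bounded_functional_sum phi (T : Type) (r : seq T) (c : T -> R[i])
  (F : T -> G -> R[i]^o) :
  bounded_functional phi -> (forall p, wS (F p)) ->
  phi (\sum_(p <- r) c p *: F p) = \sum_(p <- r) c p * phi (F p).
Proof.
move=> bphi SF; elim: r => [|p r IH].
  by rewrite !big_nil -(subrr 0) (bounded_functionalB bphi wS0 wS0) subrr.
by rewrite !big_cons bphi.1// ?IH//; exact: wS_sum.
Qed.

(** Convolution with x is approximated by one and the same combination of
    translations in both places, and translations may be moved by D_translate. *)
Lemma D_conv_Cc (x y z : G -> R) : Bc x -> Cc y -> Cc z ->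
  D (conv (cplx x) (cplx y)) (cplx z) = D (cplx y) (conv (cplx x) (cplx z)).
Proof.
move=> nx Cy Cz; have [ny nz] := (Cc_Bc Cy, Cc_Bc Cz).
have [Sx [Sy Sz]] := (Bc_wS nx, (Bc_wS ny, Bc_wS nz)).
have [b1 [K1 K10 h1]] := bounded_functional_Dl Sz;
  have [b2 [K2 K20 h2]] := bounded_functional_Dr Sy.
apply/eqP; rewrite -subr_eq0; apply/eqP.
apply: (@modulus_le_small _ (K1 + K2)); first exact: addr_ge0.
move=> e e0; have [r [ry rz]] := conv_translate_approx nx Cy Cz e0.
have Sxy : wS (conv (cplx x) (cplx y)) by exact: wS_conv.
have Sxz : wS (conv (cplx x) (cplx z)) by exact: wS_conv.
have Sry := wS_comb r ny; have Srz := wS_comb r nz.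
have E : D (translate_comb r y) (cplx z) = D (cplx y) (translate_comb r z).
  rewrite /translate_comb (bounded_functional_sum _ _ (bounded_functional_Dl Sz))
    ?(bounded_functional_sum _ _ (bounded_functional_Dr Sy)).
  - by apply: eq_bigr => p _; rewrite D_translate.
  - by move=> p; exact/Bc_wS/Bc_translate.
  - by move=> p; exact/Bc_wS/Bc_translate.
have -> : D (conv (cplx x) (cplx y)) (cplx z) - D (cplx y) (conv (cplx x) (cplx z))
  =
    D (conv (cplx x) (cplx y) - translate_comb r y) (cplx z) - D (cplx y)
      (conv (cplx x) (cplx z) - translate_comb r z).
  exact: (subr_approx (bounded_functionalB (bounded_functional_Dl Sz) Sxy Sry)
    (bounded_functionalB (bounded_functional_Dr Sy) Sxz Srz) E).
apply: (le_trans (modulusD _ _)); rewrite modulusN mulrDr; apply: lerD.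
  exact: (le_mul_small K10 (h1 _ (wSB Sxy Sry)) (ltW ry)).
exact: (le_mul_small K20 (h2 _ (wSB Sxz Srz)) (ltW rz)).
Qed.

Lemma D_conv f g h : wS f -> wS g -> wS h -> D (conv f g) h = D g (conv f h).
Proof.
move=> Sf Sg Sh; apply/eqP; rewrite -subr_eq0; apply/eqP.
apply: (bounded_functional_density
  (phi := fun f => D (conv f g) h - D g (conv f h))) Sf.
  apply: bounded_functional_diff;
    [exact: (bounded_functional_convl (bounded_functional_Dl Sh))|exact:
    (bounded_functional_convl (bounded_functional_Dr Sg))].
move=> x Cx; have Sx := Bc_wS (Cc_Bc Cx).
apply: (bounded_functional_density
  (phi := fun g => D (conv (cplx x) g) h - D g (conv (cplx x) h))) Sg.
  apply: bounded_functional_diff;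
    [exact: (bounded_functional_convr (bounded_functional_Dl Sh))|by apply:
    bounded_functional_Dl; exact: wS_conv].
move=> y Cy; have Sy := Bc_wS (Cc_Bc Cy).
apply: (bounded_functional_density
  (phi := fun h => D (conv (cplx x) (cplx y)) h - D (cplx y) (conv (cplx x) h))) Sh.
  apply: bounded_functional_diff;
    [by apply: bounded_functional_Dr;
    exact: wS_conv|exact: (bounded_functional_convr (bounded_functional_Dr Sy))].
by move=> z Cz; rewrite D_conv_Cc ?subrr//; exact: Cc_Bc.
Qed.

(** By D_conv both sides are values of D(g * h * f) at k, bracketed differently. *)
Lemma D_convAC f g h k : wS f -> wS g -> wS h -> wS k ->
  D f (conv (conv g h) k) = D f (conv (conv h g) k).
Proof.
move=> Sf Sg Sh Sk.
have [Sgh [Shf [Sgk Shg]]] := (wS_conv Sg Sh,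
  (wS_conv Sh Sf, (wS_conv Sg Sk, wS_conv Sh Sg))).
have [Lf [Lg [Lh Lk]]] := (wS_L Sf, (wS_L Sg, (wS_L Sh, wS_L Sk))).
transitivity (D (conv (conv g h) f) k); first exact/esym/D_conv.
transitivity (D (conv g (conv h f)) k).
  by apply: (bounded_functional_null (bounded_functional_Dl Sk));
    [exact: wS_conv|exact: wS_conv|exact: convA].
transitivity (D (conv h f) (conv g k)); first exact: D_conv.
transitivity (D f (conv h (conv g k))); first exact: D_conv.
apply/esym; apply: (bounded_functional_null (bounded_functional_Dr Sf));
  [exact: wS_conv|exact: wS_conv|exact: convA].
Qed.

(** D_convAC with an approximate unit in the place of k. *)
Lemma D_convC f g h : wS f -> wS g -> wS h -> D f (conv g h) = D f (conv h g).
Proof.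
move=> Sf Sg Sh; apply/eqP; rewrite -subr_eq0; apply/eqP.
have bD := bounded_functional_Dr Sf.
apply: (bounded_functional_density
  (phi := fun g => D f (conv g h) - D f (conv h g))) Sg.
  by apply: bounded_functional_diff;
    [exact: (bounded_functional_convl bD)|exact: (bounded_functional_convr bD)].
move=> u Cu; have Su := Bc_wS (Cc_Bc Cu).
apply: (bounded_functional_density
  (phi := fun h => D f (conv (cplx u) h) - D f (conv h (cplx u)))) Sh.
  by apply: bounded_functional_diff;
    [exact: (bounded_functional_convr bD)|exact: (bounded_functional_convl bD)].
move=> v Cv; have Sv := Bc_wS (Cc_Bc Cv).
have bu := bounded_functional_convr bD Su;
  have bv := bounded_functional_convr bD Sv.
have [[_ [K1 K10 h1]] [_ [K2 K20 h2]]] := (bu, bv).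
apply: (@modulus_le_small _ (K1 + K2)); first exact: addr_ge0.
move=> e e0; have [b [nb ub vb]] := approx_unit Cu Cv e0; have Sb := Bc_wS nb.
have Sub : wS (conv (cplx u) (cplx b)) by exact: wS_conv.
have Svb : wS (conv (cplx v) (cplx b)) by exact: wS_conv.
have Suv : wS (conv (cplx u) (cplx v)) by exact: wS_conv.
have Svu : wS (conv (cplx v) (cplx u)) by exact: wS_conv.
have E : D f (conv (cplx u) (conv (cplx v) (cplx b))) =
  D f (conv (cplx v) (conv (cplx u) (cplx b))).
  have [Lu [Lv Lb]] := (wS_L Su, (wS_L Sv, wS_L Sb)).
  transitivity (D f (conv (conv (cplx u) (cplx v)) (cplx b))).
    apply/esym; apply: (bounded_functional_null bD);
      [exact: wS_conv|exact: wS_conv|exact: convA].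
  transitivity (D f (conv (conv (cplx v) (cplx u)) (cplx b)));
    first exact: D_convAC.
  by apply: (bounded_functional_null bD);
    [exact: wS_conv|exact: wS_conv|exact: convA].
have -> : D f (conv (cplx u) (cplx v)) - D f (conv (cplx v) (cplx u)) =
    D f (conv (cplx u) (cplx v - conv (cplx v) (cplx b))) - D f
      (conv (cplx v) (cplx u - conv (cplx u) (cplx b))).
  exact: (subr_approx (bounded_functionalB bu Sv Svb)
    (bounded_functionalB bv Su Sub) E).
apply: (le_trans (modulusD _ _)); rewrite modulusN mulrDr; apply: lerD.
  apply: (le_mul_small K10 (h1 _ (wSB Sv Svb))).
  by rewrite (nrmBC (wS_L Sv) (wS_L Svb)) ltW.
apply: (le_mul_small K20 (h2 _ (wSB Su Sub))).
by rewrite (nrmBC (wS_L Su) (wS_L Sub)) ltW.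
Qed.

(** By D_conv and D_convC the derivation rule for D(f * h)(k) reduces to
    D f (h * k) = 0, and by approx_unit the products are dense. *)
Lemma D_eq0 f g : wS f -> wS g -> D f g = 0.
Proof.
move=> Sf Sg; have bD := bounded_functional_Dr Sf.
have Dconv0 h k : wS h -> wS k -> D f (conv h k) = 0.
  move=> Sh Sk; have := D_mul Sf Sh Sk.
  rewrite (D_conv Sf Sh Sk) (D_convC Sh Sf Sk).
  by move/eqP; rewrite -subr_eq0 opprD addrA subrr sub0r oppr_eq0 => /eqP.
apply: (bounded_functional_density bD) Sg => u Cu; have Su := Bc_wS (Cc_Bc Cu).
apply: (bounded_functional_close bD Su) => e e0;
  have [b [nb ub _]] := approx_unit Cu Cu e0.
have Sb := Bc_wS nb; have Sub : wS (conv (cplx u) (cplx b)) by exact: wS_conv.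
exists (conv (cplx u) (cplx b)); first by split => //; exact: Dconv0.
by rewrite (nrmBC (wS_L Su) (wS_L Sub)).
Qed.

End WeightedAlgebra.

(** * Weak amenability *)

Theorem theorem3p1 (R : realType) (G : topologicalZmodType)
    (hausdorffG : hausdorff_space G) (lcG : locally_compact [set: G])
    (mu : {measure set (borel G) -> \bar R}) (haar_mu : haar_measure mu)
    (w : G -> R) (weight_w : weight mu w)
    (Phi Psi : R -> \bar R) (pair : complementary_pair Phi Psi)
    (Phi_continuous : continuous_nneg Phi) (Phi_incr : increasing_nneg Phi)
    (Psi_continuous : continuous_nneg Psi) (Psi_incr : increasing_nneg Psi)
    (LPhiw_alg : LPhiw_banach_algebra mu Phi Psi w)
    (no_hom : ~ exists xi : G -> R[i]^o,
      [/\ {morph xi : s t / s + t}, continuous xi,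
          (exists s, xi s <> 0) & Linfty mu (tilde w xi)]) :
  weakly_amenable (SPhiw mu Phi Psi w).
Proof.
move=> D derD; exists (fun _ => 0).
  split=> [a x y _ _|x _ _|]; first by rewrite scaler0 addr0.
    by [].
  exists 0 => x _; rewrite mul0e /modulus.
  by rewrite ComplexField.Normc.normc0.
move=> x z Sx Sz; rewrite subrr.
exact: (D_eq0 hausdorffG lcG haar_mu weight_w pair Phi_incr Psi_incr
  LPhiw_alg.2 no_hom derD Sx Sz).
Qed.
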